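(* Let $\nu>\frac12$, let $m$ be an integer with $1\le m\le\lfloor\nu-\frac12\rfloor$, let $z\in\mathbb{C}$ with $|z|<1$, and put $\tau=|z|^2$. Let $\sum_{j\ge0}p_j^{(\nu,\tau,m)}\delta_j$ be the generalized negative binomial distribution of parameters $(\nu,\tau,m)$ and let $\sum_{j\ge 0}p_j^{(\nu,\tau,0)}\delta_j$ be the negative binomial distribution (case $m=0$). Then the generalized negative binomial distribution of parameters $(\nu,\tau,m)$ admits the decomposition $$\sum_{j\ge0}p_j^{(\nu,\tau,m)}\delta_j=\left(\sum_{j\ge0}p_j^{(\nu,\tau,0)}\delta_j\right)\star\delta_m\star\left\{\delta_0+\sum_{k=1}^mQ_k^{(\nu,m)}\left(\frac{\tau}{(1-\tau)^2}\right)[\delta_k+\delta_{-k}]\right\}$$ $$=\left(\sum_{j\ge0}p_j^{(\nu,\tau,0)}\delta_j\right)\star\sum_{k=0}^{2m}Q_{|k-m|}^{(\nu,m)}\left(\frac{\tau}{(1-\tau)^2}\right)\delta_k,$$ where $\star$ denotes convolution of finite signed measures on $\mathbb{R}$.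
   Context: $\delta_a$ is the Dirac mass at $a$. For real $c$ and integer $k\ge0$, $\binom{c}{k}=\frac{c(c-1)\cdots(c-k+1)}{k!}$. Define the polynomials $$Q_k^{(\nu,m)}(x):=(-1)^k\sum_{j=k}^m\binom{2\nu-m-1}{j}\binom{m}{j}\binom{2j}{j-k}(-x)^j,\qquad 1\le k\le m,\qquad\qquad Q_0^{(\nu,m)}(x):=1.$$ Jacobi polynomials: for real $a,b>-1$, $P_n^{(a,b)}(x)=\sum_{k=0}^n\binom{n+a}{k}\binom{n+b}{n-k}\left(\frac{x-1}{2}\right)^{n-k}\left(\frac{x+1}{2}\right)^k$. Generalized negative binomial distribution (GNBD) of parameters $(\nu,\tau,m)$, where $0\le m\le\lfloor\nu-\frac12\rfloor$ and $\tau=|z|^2\in[0,1)$: the probability distribution on $\{0,1,2,\dots\}$ with masses $$p_j^{(\nu,\tau,m)}:=\gamma_j^{(\nu,m)}(1-\tau)^{2\nu-2m}\,\tau^{|m-j|}\left(P_{\min(m,j)}^{(|m-j|,\,2\nu-2m-1)}(1-2\tau)\right)^2,$$ with $\gamma_j^{(\nu,m)}=\frac{j!\,\Gamma(2\nu-m)}{m!\,\Gamma(2\nu-2m+j)}$ if $j\le m$, $\gamma_j^{(\nu,m)}=\frac{m!\,\Gamma(2\nu-2m+j)}{j!\,\Gamma(2\nu-m)}$ if $j\ge m$, and $0^0=1$. For $m=0$ it is the negative binomial distribution, $p_j^{(\nu,\tau,0)}=\frac{\Gamma(2\nu+j)}{j!\,\Gamma(2\nu)}(1-\tau)^{2\n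u}\tau^j$.
   Formalization: Q_0 is not the constant 1 but the value at k=0 of the sum defining Q_k, both in the second display and as the coefficient of δ_0 in the first; with Q_0=1 the identity fails, e.g. for m=1 and 0<τ<1, where the right side has total mass above 1. *)

(* Defs.v *)
From HB Require Import structures.
From mathcomp Require Import all_boot all_order all_algebra.
From mathcomp Require Import all_classical all_reals all_analysis.
From mathcomp Require Import measurable_realfun complex.
From mathcomp Require Import ring.

Set Implicit Arguments.
Unset Strict Implicit.
Unset Printing Implicit Defensive.

Import Order.TTheory GRing.Theory Num.Theory.
Import numFieldNormedType.Exports.

Local Open Scope classical_set_scope.
Local Open Scope ring_scope.

Section special_functions.
Context {R : realType}.
Implicit Types (a b c nu tau x : R) (j k m n : nat).

Definition gbinom c k : R := (\prod_(i < k) (c - i%:R)) / k`!%:R.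

Definition Gamma x : R :=
  \int[lebesgue_measure]_(t in `]0, +oo[) (t `^ (x - 1) * expR (- t)).

Definition jacobi n a b x : R :=
  \sum_(k < n.+1) gbinom (n%:R + a) k * gbinom (n%:R + b) (n - k)
    * ((x - 1) / 2) ^+ (n - k) * ((x + 1) / 2) ^+ k.

Definition gnbd_coef nu m j : R :=
  if (j <= m)%N
  then j`!%:R * Gamma (2 * nu - m%:R) / (m`!%:R * Gamma (2 * nu - 2 * m%:R + j%:R))
  else m`!%:R * Gamma (2 * nu - 2 * m%:R + j%:R) / (j`!%:R * Gamma (2 * nu - m%:R)).

(* In [`|m - j|%N] the subtraction is the integer one. *)
Definition gnbd nu tau m j : R :=
  gnbd_coef nu m j * (1 - tau) `^ (2 * nu - 2 * m%:R) * tau ^+ `|m - j|%N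
  * jacobi (minn m j) (`|m - j|%N)%:R (2 * nu - 2 * m%:R - 1) (1 - 2 * tau) ^+ 2.

(* The defining formula is used for k = 0 as well.  The constant 1 in place of
   [Qpoly nu m 0] would give the decomposition of the generalized negative
   binomial distribution a right-hand side whose mass differs from 1: for m = 1
   the masses at -1, 0, 1 are (2 nu - 2) x, 1 - 2 (2 nu - 2) x, (2 nu - 2) x. *)
Definition Qpoly nu m k x : R :=
  (-1) ^+ k * \sum_(k <= j < m.+1)
    gbinom (2 * nu - m%:R - 1) j * 'C(m, j)%:R * 'C(2 * j, j - k)%:R * (- x) ^+ j.

End special_functions.

Section signed_measures.
Context {R : realType}.
Local Notation T := (measurableTypeR R).
Local Notation signed := (charge T R).
Local Open Scope ereal_scope.

Definition signed0 : signed := czero.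
Definition signed_add (mu nu : signed) : signed := cadd mu nu.
Definition signed_scale (r : R) (mu : signed) : signed := cscale r mu.
Definition delta (a : R) : signed :=
  charge_of_finite_measure (\d_(a : T) : {finite_measure set T -> \bar R}).

Section convolution_finite_measures.
Variables mu nu : {finite_measure set T -> \bar R}.

Definition mconv : set T -> \bar R :=
  pushforward (mu \x nu) (fun xy : T * T => (xy.1 + xy.2)%R : T).

Let madd : measurable_fun [set: T * T] (fun xy : T * T => (xy.1 + xy.2)%R : T).
Proof. by apply: measurable_funD; [exact: measurable_fst|exact: measurable_snd]. Qed.

Let preimage_measurable (A : set T) : measurable A ->
  measurable ((fun xy : T * T => (xy.1 + xy.2)%R : T) @^-1` A).
Proof. by move=> mA; rewrite -[X in measurable X]setTI; exact: madd. Qed.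

Let mconv0 : mconv set0 = 0.
Proof. by rewrite /mconv /pushforward preimage_set0 measure0. Qed.

Let mconv_ge0 A : 0 <= mconv A.
Proof. exact: measure_ge0. Qed.

Let mconv_sigma_additive : semi_sigma_additive mconv.
Proof.
move=> F mF tF mUF; rewrite /mconv /pushforward preimage_bigcup.
apply: measure_semi_sigma_additive.
- by move=> n; exact: preimage_measurable.
- apply/trivIsetP => /= i j _ _ ij; rewrite -preimage_setI.
  by move/trivIsetP : tF => /(_ _ _ _ _ ij) ->//; rewrite preimage_set0.
- by rewrite -preimage_bigcup; exact: preimage_measurable.
Qed.

HB.instance Definition _ := isMeasure.Build _ _ _ mconv
  mconv0 mconv_ge0 mconv_sigma_additive.

Let mconv_fin : fin_num_fun mconv.
Proof.
move=> A mA; rewrite ge0_fin_numE//.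
apply: (@le_lt_trans _ _ ((mu \x nu) [set: T * T])).
  rewrite /mconv /pushforward.
  apply: le_measure => //; rewrite inE//; exact: preimage_measurable.
rewrite -setXTT product_measure1E//.
by apply: lte_mul_pinfty; rewrite ?fin_num_measure// -ge0_fin_numE// fin_num_measure.
Qed.

HB.instance Definition _ := @Measure_isFinite.Build _ _ _ mconv mconv_fin.

End convolution_finite_measures.

Definition hahn_pos (mu : signed) : set T := sval (cid (Hahn_decomposition mu)).
Definition hahn_neg (mu : signed) : set T :=
  sval (cid (svalP (cid (Hahn_decomposition mu)))).

Lemma hahnP (mu : signed) : hahn_decomposition mu (hahn_pos mu) (hahn_neg mu).
Proof. exact: (svalP (cid (svalP (cid (Hahn_decomposition mu))))). Qed.

Definition pos_part (mu : signed) : {finite_measure set T -> \bar R} :=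
  jordan_pos (hahnP mu).
Definition neg_part (mu : signed) : {finite_measure set T -> \bar R} :=
  jordan_neg (hahnP mu).

(* The law of the sum under the product of the two Jordan decompositions; on
   measurable sets it does not depend on the Hahn decompositions chosen. *)
Definition charge_conv (mu nu : signed) : signed :=
  cadd
    (cadd (charge_of_finite_measure (mconv (pos_part mu) (pos_part nu)))
          (charge_of_finite_measure (mconv (neg_part mu) (neg_part nu))))
    (copp
      (cadd (charge_of_finite_measure (mconv (pos_part mu) (neg_part nu)))
            (charge_of_finite_measure (mconv (neg_part mu) (pos_part nu))))).

Definition atomic (p : nat -> R) (A : set T) : \bar R :=
  \sum_(0 <= j <oo) (p j)%:E * \d_(j%:R : T) A.

Section atomic_charge.
Variable p : nat -> R.

(* [atomic p] as a signed measure; the null one unless p is absolutely summable. *)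
Definition atomic_charge (A : set T) : \bar R :=
  if `[< summable [set: nat] (EFin \o p) >] then atomic p A else 0.

Let ppos j : {nonneg R} := NngNum (funrpos_ge0 p j).
Let pneg j : {nonneg R} := NngNum (funrneg_ge0 p j).
Let mpos : {measure set T -> \bar R} := mseries (fun j => mscale (ppos j) \d_(j%:R : T)) 0.
Let mneg : {measure set T -> \bar R} := mseries (fun j => mscale (pneg j) \d_(j%:R : T)) 0.

Let atomicE A : summable [set: nat] (EFin \o p) ->
  [/\ mpos A \is a fin_num, mneg A \is a fin_num & atomic p A = mpos A - mneg A].
Proof.
move=> sp.
pose g j : R := (p j * ((j%:R : T) \in A)%:R)%R.
have fE j : (p j)%:E * \d_(j%:R : T) A = (EFin \o g) j by rewrite diracE.
have gp j : (g^\+ j)%R%:E = mscale (ppos j) \d_(j%:R : T) A.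
  rewrite /g /mscale /= diracE /funrpos -EFinM.
  by case: (_ \in A); rewrite ?mulr1 ?mulr0 ?maxxx.
have gn j : (g^\- j)%R%:E = mscale (pneg j) \d_(j%:R : T) A.
  rewrite /g /mscale /= diracE /funrneg -EFinM.
  by case: (_ \in A); rewrite ?mulr1 ?mulr0 ?oppr0 ?maxxx.
have sg : summable [set: nat] (EFin \o g).
  apply: le_lt_trans sp; apply: le_esum => j _ /=.
  rewrite lee_fin /g normrM ler_piMr//.
  by case: (_ \in A); rewrite ?normr1 ?normr0.
have mposE : mpos A = \esum_(i in [set: nat]) (EFin \o g)^\+ i.
  rewrite -nneseries_esumT; last by move=> i; exact: funepos_ge0.
  by apply: eq_eseriesr => i _; rewrite funerpos; exact/esym/gp.
have mnegE : mneg A = \esum_(i in [set: nat]) (EFin \o g)^\- i.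
  rewrite -nneseries_esumT; last by move=> i; exact: funeneg_ge0.
  by apply: eq_eseriesr => i _; rewrite funerneg; exact/esym/gn.
split.
- rewrite mposE; have := summable_funepos sg; rewrite summableE.
  by under eq_esum do rewrite gee0_abs ?funepos_ge0//.
- rewrite mnegE; have := summable_funeneg sg; rewrite summableE.
  by under eq_esum do rewrite gee0_abs ?funeneg_ge0//.
rewrite mposE mnegE /atomic (eq_eseriesr (fun j _ => fE j)).
have sg' : summable (fun x : nat => xpredT x) (EFin \o g).
  by rewrite (_ : (fun=> _) = [set: nat])//; apply/seteqP; split.
by rewrite (summable_eseries_esum sg') (_ : (fun=> _) = [set: nat])//; apply/seteqP; split.
Qed.

Let atomic0 : atomic_charge set0 = 0.
Proof.
rewrite /atomic_charge; case: asboolP => // sp.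
by have [_ _ ->] := atomicE set0 sp; rewrite !measure0 sube0.
Qed.

Let atomic_fin A : measurable A -> atomic_charge A \is a fin_num.
Proof.
move=> mA; rewrite /atomic_charge; case: asboolP => // sp.
by have [? ? ->] := atomicE A sp; rewrite fin_numB; apply/andP.
Qed.

Let atomic_sigma_additive : semi_sigma_additive atomic_charge.
Proof.
move=> F mF tF mUF; rewrite /atomic_charge; case: asboolP => sp; last first.
  by under eq_fun do rewrite big1//; exact: cvg_cst.
have [pU nU ->] := atomicE (\bigcup_n F n) sp.
rewrite (_ : (fun _ => _) = (fun n => \sum_(0 <= i < n) mpos (F i)
                              - \sum_(0 <= i < n) mneg (F i))).
  apply: cvgeB; first by rewrite fin_num_adde_defr// fin_numN.
  - exact: measure_semi_sigma_additive.
  - exact: measure_semi_sigma_additive.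
apply/funext => n; rewrite -sumeN; last first.
  by move=> i j _ _; rewrite fin_num_adde_defl//; have [] := atomicE (F j) sp.
rewrite -big_split/=; apply: eq_bigr => i _.
by have [_ _ ->] := atomicE (F i) sp.
Qed.

HB.instance Definition _ := isCharge.Build _ _ _ atomic_charge
  atomic0 atomic_fin atomic_sigma_additive.

End atomic_charge.

Definition atomic_signed (p : nat -> R) : signed := atomic_charge p.

End signed_measures.

Section negative_binomial.
Context {R : realType}.
Implicit Types (a c nu tau x t : R) (j n : nat).

Lemma gbinom0 c : gbinom c 0 = 1 :> R.
Proof. by rewrite /gbinom big_ord0 fact0 divr1. Qed.

Lemma jacobi0 a b x : jacobi 0 a b x = 1 :> R.
Proof. by rewrite /jacobi big_ord1 /= !gbinom0 !expr0 !mulr1. Qed.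

Lemma gnbd0E nu tau j :
  gnbd nu tau 0 j = Gamma (2 * nu + j%:R) / (j`!%:R * Gamma (2 * nu))
                    * (1 - tau) `^ (2 * nu) * tau ^+ j.
Proof.
rewrite /gnbd min0n jacobi0 expr1n mulr1 !mulr0 !subr0 sub0r abszN absz_nat.
congr (_ * _ * _); rewrite /gnbd_coef !mulr0 !subr0 fact0 !mul1r.
by case: j => [|j] //=; rewrite fact0 addr0 !mul1r.
Qed.

Lemma Gamma_ge0 x : 0 <= Gamma x.
Proof. by apply: Rintegral_ge0 => t _; rewrite mulr_ge0 ?powR_ge0 ?expR_ge0. Qed.

Let powR_le a c : 1 < a -> 0 < c ->
  exists2 C : R, 0 <= C & forall t, 0 < t -> t `^ (a - 1) <= C * expR (c * t).
Proof.
move=> a1 c0; set n := (Num.truncn (a - 1)).+1.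
exists (n`!%:R / c ^+ n * expR c).
  by rewrite mulr_ge0 ?divr_ge0 ?exprn_ge0 ?expR_ge0 ?ltW.
move=> t t0; have t1 : 1 <= t + 1 by rewrite lerDr ltW.
apply: (@le_trans _ _ ((t + 1) `^ (a - 1))).
  by apply: ge0_ler_powR; rewrite ?nnegrE ?subr_ge0 ?lerDl ?addr_ge0 ?(ltW a1) ?(ltW t0).
apply: (@le_trans _ _ ((t + 1) ^+ n)).
  rewrite -powR_mulrn ?ler_powR//; last by rewrite ltW// (lt_le_trans _ t1).
  by rewrite ltW// /n truncnS_gt.
have := @expR_ge1Dxn R (c * (t + 1)) (Num.truncn (a - 1)).
rewrite -/n => h.
have {}h : (c * (t + 1)) ^+ n / n`!%:R <= expR (c * (t + 1)).
  by rewrite (le_trans _ (h _)) ?lerDr// mulr_ge0 ?(ltW c0)// (le_trans _ t1).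
have -> : n`!%:R / c ^+ n * expR c * expR (c * t) = n`!%:R / c ^+ n * expR (c * (t + 1)).
  by rewrite (_ : c * (t + 1) = c + c * t) ?expRD ?mulrA//; ring.
rewrite mulrAC ler_pdivlMr ?exprn_gt0// mulrC -exprMn.
by move: h; rewrite ler_pdivrMr ?ltr0n ?fact_gt0// [X in _ -> _ <= X]mulrC.
Qed.

Local Open Scope ereal_scope.
Local Notation mu := (@lebesgue_measure R).
Local Notation D := (`]0%R, +oo[%classic : set R).

Let measurable_term a c : measurable_fun D
  (fun t : R => (t `^ (a - 1) * expR (- (c * t)))%:E).
Proof.
apply/measurable_EFinP; apply: measurable_funM.
  by apply: measurable_funTS; exact: measurable_powR.
apply: measurable_funTS; apply: (measurableT_comp (@measurable_expR R)).
by apply: measurableT_comp => //; exact: mulrl_measurable.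
Qed.

Let integral_exp_lty c : (0 < c)%R -> \int[mu]_(t in D) (expR (- (c * t)))%:E < +oo.
Proof.
move=> c0.
have mexp : measurable_fun D (fun t : R => (expR (- (c * t)))%:E).
  apply: eq_measurable_fun (measurable_term 1 c) => t _.
  by rewrite subrr powRr0 mul1r.
have mpdf : measurable_fun D (EFin \o exponential_pdf c).
  apply: measurable_funTS; apply/measurable_EFinP.
  exact: measurable_exponential_pdf.
have : \int[mu]_(t in D) (c%:E * (expR (- (c * t)))%:E) <= 1.
  rewrite -(integral_exponential_pdf c0).
  apply: (@le_trans _ _ (\int[mu]_(t in D) (exponential_pdf c t)%:E)).
    rewrite le_eqVlt; apply/orP; left; apply/eqP.
    apply: eq_integral => t; rewrite inE/= in_itv/= andbT => t0.
    by rewrite exponential_pdfE ?ltW// EFinM mulNr.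
  apply: ge0_subset_integral => //.
    by apply/measurable_EFinP; exact: measurable_exponential_pdf.
  by move=> t _; rewrite lee_fin exponential_pdf_ge0// ltW.
rewrite ge0_integralZl//; last by rewrite lee_fin ltW.
by rewrite -lee_pdivlMl// mule1 => /le_lt_trans; apply; exact: ltry.
Qed.

Let integral_gamma_lty a c : (1 < a)%R -> (0 < c)%R ->
  \int[mu]_(t in D) (t `^ (a - 1) * expR (- (c * t)))%:E < +oo.
Proof.
move=> a1 c0; have c20 : (0 < c / 2)%R by rewrite divr_gt0.
have [C C0 hC] := powR_le a1 c20.
have mexp : measurable_fun D (fun t : R => (expR (- (c / 2 * t)))%:E).
  apply: eq_measurable_fun (measurable_term 1 (c / 2)) => t _.
  by rewrite subrr powRr0 mul1r.
apply: (@le_lt_trans _ _ (\int[mu]_(t in D) (C%:E * (expR (- (c / 2 * t)))%:E))).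
  apply: ge0_le_integral => //.
  - by move=> t _; rewrite lee_fin mulr_ge0 ?powR_ge0 ?expR_ge0.
  - exact: measurable_term.
  - by apply: measurable_funeM.
  move=> t; rewrite /= in_itv/= andbT => t0; rewrite -EFinM lee_fin.
  apply: (le_trans (ler_wpM2r (expR_ge0 _) (hC t t0))).
  have -> : (C * expR (c / 2 * t) * expR (- (c * t)) = C * expR (- (c / 2 * t)))%R.
    by rewrite (_ : - (c / 2 * t) = c / 2 * t + - (c * t))%R ?expRD ?mulrA//; field.
  exact: lexx.
rewrite ge0_integralZl//; apply: lte_mul_pinfty => //.
exact: integral_exp_lty.
Qed.

Lemma summable_gnbd0 nu tau : (2^-1 < nu)%R -> (0 <= tau < 1)%R ->
  summable [set: nat] (EFin \o gnbd nu tau 0).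
Proof.
move=> nu2 /andP[tau0 tau1].
have a1 : (1 < 2 * nu)%R by rewrite -ltr_pdivrMl// mulr1.
set a := (2 * nu)%R in a1.
pose K := ((Gamma a)^-1 * (1 - tau) `^ a)%R.
have K0 : (0 <= K)%R by rewrite mulr_ge0 ?invr_ge0 ?Gamma_ge0 ?powR_ge0.
pose f j (t : R) : \bar R :=
  (t `^ (a - 1) * expR (- t) * ((tau * t) ^+ j / j`!%:R))%:E.
have fD j t : D t -> 0 <= f j t.
  rewrite /= in_itv/= andbT => t0; rewrite lee_fin.
  by rewrite !mulr_ge0 ?powR_ge0 ?expR_ge0 ?invr_ge0 ?exprn_ge0// mulr_ge0// ltW.
have mf j : measurable_fun D (f j).
  apply/measurable_EFinP; apply: measurable_funM.
    apply/measurable_EFinP; apply: eq_measurable_fun (measurable_term a 1) => t _.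
    by rewrite mul1r.
  apply: measurable_funTS; apply: measurable_funM => //.
  by apply: measurable_funX; exact: mulrl_measurable.
have fine_le (I : \bar R) : 0 <= I -> (fine I)%:E <= I.
  by case: I => [r||] //= _; exact: leey.
have le1 j : (gnbd nu tau 0 j)%:E <= K%:E * \int[mu]_(t in D) f j t.
  have -> : gnbd nu tau 0 j = (K * (tau ^+ j / j`!%:R * Gamma (a + j%:R)))%R.
    by rewrite gnbd0E -/a /K invfM; ring.
  rewrite EFinM; apply: lee_wpmul2l; first by rewrite lee_fin.
  rewrite (_ : \int[mu]_(t in D) f j t = (tau ^+ j / j`!%:R)%:E *
     \int[mu]_(t in D) (t `^ (a + j%:R - 1) * expR (- t))%:E).
    rewrite EFinM; apply: lee_wpmul2l.
      by rewrite lee_fin divr_ge0 ?exprn_ge0.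
    rewrite /Gamma /Rintegral.
    apply: fine_le; apply: integral_ge0 => t _.
    by rewrite lee_fin mulr_ge0 ?powR_ge0 ?expR_ge0.
  rewrite -ge0_integralZl//; last 3 first.
  - apply: eq_measurable_fun (measurable_term (a + j%:R) 1) => t _.
    by rewrite mul1r.
  - by move=> t _; rewrite lee_fin mulr_ge0 ?powR_ge0 ?expR_ge0.
  - by rewrite lee_fin divr_ge0 ?exprn_ge0.
  apply: eq_integral => t; rewrite inE/= in_itv/= andbT => t0.
  rewrite /f -EFinM (_ : (a + j%:R - 1 = (a - 1) + j%:R)%R); last by ring.
  rewrite (@powRD _ _ (a - 1) j%:R); last by rewrite (gt_eqF t0) implybT.
  by rewrite (powR_mulrn j (ltW t0)) exprMn; congr EFin; ring.
rewrite /summable -nneseries_esumT//.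
have g0 j : (0 <= gnbd nu tau 0 j)%R.
  rewrite gnbd0E !mulr_ge0 ?powR_ge0 ?exprn_ge0 ?Gamma_ge0//.
  by rewrite invr_ge0 mulr_ge0 ?Gamma_ge0.
apply: (@le_lt_trans _ _ (\sum_(0 <= j <oo) K%:E * \int[mu]_(t in D) f j t)).
  by apply: lee_nneseries => //= j _; rewrite ger0_norm.
rewrite nneseriesZl; last first.
  by move=> j _; apply: integral_ge0 => t; exact: fD.
rewrite -integral_nneseries//.
rewrite (_ : \int[mu]_(t in D) _ =
   \int[mu]_(t in D) (t `^ (a - 1) * expR (- ((1 - tau) * t)))%:E).
  apply: lte_mul_pinfty => //; apply: integral_gamma_lty => //.
  by rewrite subr_gt0.
apply: eq_integral => t; rewrite inE/= in_itv/= andbT => t0.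
rewrite /f; under eq_eseriesr do rewrite EFinM.
rewrite nneseriesZl; last first.
  by move=> j _; rewrite lee_fin divr_ge0// exprn_ge0// mulr_ge0// ltW.
rewrite (_ : (\sum_(0 <= j <oo) _) = (expR (tau * t))%:E).
  rewrite -EFinM (_ : - ((1 - tau) * t) = - t + tau * t)%R; last by ring.
  by rewrite expRD mulrA.
rewrite /expR -EFin_lim; last exact: is_cvg_series_exp_coeff.
apply/congr_lim/funext => n /=.
by rewrite /series/= -sumEFin.
Qed.

End negative_binomial.

(* Main.v *)
Require Import Defs.
From mathcomp Require Import all_boot all_order all_algebra.
From mathcomp Require Import all_classical all_reals all_analysis.
From mathcomp Require Import measurable_realfun complex.
From mathcomp Require Import ring lra zify.

Import Order.TTheory GRing.Theory Num.Theory.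
Import numFieldNormedType.Exports.

Local Open Scope classical_set_scope.
Local Open Scope ring_scope.

(** Write [b = 2 nu - 2 m >= 1] and let [mcoef t b m n] be the coefficient of
    [w^n] in [(t - w)^m (1 - w)^(-b-m)].  Up to normalisation these are the
    matrix coefficients, in the basis of monomials, of a Moebius map acting in
    a discrete series representation of SU(1,1).  Two facts make the theorem
    true.

    1. The masses of the generalized distribution factor as
    [p_n = (1 - t)^b mcoef_(m,n) mcoef_(n,m)] ([gnbd_mcoef]).  Indeed, up to sign,
    one factor is a power of [t] times the Jacobi polynomial of the definition
    ([mcoef_ge]) and the other is the same polynomial times a ratio of binomial
    coefficients [C(b + n - 1, n)] ([mcoef_le]); that ratio is the quotient of
    Gamma functions and factorials in the definition, because
    [Gamma (a + 1) = a Gamma a].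

    2. Because [mcoef_(n,m)] is the coefficient of [w^m] in
    [(t - w)^n (1 - w)^(-b-n)], the sum over [n] of
    [u^n mcoef_(m,n) mcoef_(n,m)] is the coefficient of [w^m] in the
    composition of two Moebius maps,
      [(t (1 - w) - u (t - w))^m ((1 - w) - u (t - w))^(-b-m)].
    Regrouping the powers of [w] and applying the binomial transform
    [binom_transform], this coefficient equals
      [(1 - t u)^(-b-2m) sum_l C(c,l) C(m,l) t^l (1-t)^(2(m-l)) u^(m-l) (1-u)^(2l)]
    with [c = b + m - 1].  The first factor is, up to a constant, the generating
    function of the negative binomial distribution of parameter
    [2 nu = b + 2 m]; the second one is a polynomial of degree at most [2 m] whose
    coefficients are the values of [Q_|k-m|] times [(1 - t)^(2 m)]
    ([shift_poly_Qpoly]).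

    Fact 2 is an identity between coefficients that are polynomials in [b], so
    it is enough to prove it at [b = - N] for all large integers [N]
    ([polyfun_eq]), where every series above is a polynomial and the
    computation takes place in polynomials in two variables
    ([coef_core_neg], [mcoef_mul]).

    The result is [gnbd_convolution], an identity between sequences.  To read
    it as an identity between measures, one shows that convolving a signed
    measure with a finite combination of Dirac masses is the corresponding
    combination of translates ([charge_conv_finite_combination]), and that
    absolutely convergent series may be shifted and combined term by term
    ([atomic_convolution]). *)

(** * Binomial coefficients with a real upper argument *)

Lemma bin_trinomial m l i :
  ('C(m, l + i) * 'C(l + i, l) = 'C(m, l) * 'C(m - l, i))%N.
Proof.
have [h|h] := leqP (l + i) m; last first.
  rewrite (bin_small h) mul0n; apply/esym/eqP; rewrite muln_eq0.
  have [lm|ml] := leqP l m; last by rewrite bin_small.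
  by rewrite (@bin_small (m - l)) ?orbT //; lia.
have lm : (l <= m)%N by lia.
have im : (i <= m - l)%N by lia.
have e1 := bin_fact h; have e2 := bin_fact (leq_addr i l).
have e3 := bin_fact lm.
have e4 := bin_fact im; rewrite -subnDA in e4.
have := fact_gt0 l; have := fact_gt0 i; have := fact_gt0 (m - (l + i)).
rewrite addKn in e2.
have e5 : ('C(m, l + i) * 'C(l + i, l) * (l`! * i`! * (m - (l + i))`!) = m`!)%N.
  by rewrite -e1 -e2; ring.
have e6 : ('C(m, l) * 'C(m - l, i) * (l`! * i`! * (m - (l + i))`!) = m`!)%N.
  by rewrite -e3 -e4; ring.
move=> a b d; apply/eqP.
by rewrite -(@eqn_pmul2r (l`! * i`! * (m - (l + i))`!)) ?muln_gt0 ?a ?b ?d // e5 e6.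
Qed.

(** The coefficient of [w^n] in [(1 - w)^(-b)]. *)
Definition multichoose {R : realType} (b : R) (n : nat) : R :=
  gbinom (b + n%:R - 1) n.

Section Binomials.
Context {R : realType}.
Implicit Types (a b c x : R) (i j k l m n : nat).

Let natS_neq0 k : 1 + k%:R != 0 :> R.
Proof. by rewrite addrC natr1 pnatr_eq0. Qed.

Let fact_neq0 k : k`!%:R != 0 :> R.
Proof. by rewrite pnatr_eq0 -lt0n fact_gt0. Qed.

Lemma gbinomS c k : gbinom c k.+1 * k.+1%:R = gbinom c k * (c - k%:R).
Proof.
rewrite /gbinom big_ord_recr /= factS natrM invfM.
by field; rewrite natS_neq0 fact_neq0.
Qed.

(** Stated for a real upper argument, so that Vandermonde's identity follows by
    induction on the integer summand alone. *)
Lemma gbinom_pascal c k : gbinom (c + 1) k.+1 = gbinom c k.+1 + gbinom c k.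
Proof.
have E l : gbinom (c + 1) l.+1 = (c + 1) / l.+1%:R * gbinom c l.
  rewrite /gbinom big_ord_recl /= subr0 factS natrM invfM.
  rewrite (eq_bigr (fun i : 'I_l => c - i%:R)); first by ring.
  by move=> i _; rewrite /bump /= natrD; ring.
have h : (k.+1%:R : R) != 0 by rewrite pnatr_eq0.
rewrite E; apply: (mulIf h); rewrite [RHS]mulrDl gbinomS.
by field.
Qed.

Lemma gbinom_nat n k : gbinom n%:R k = 'C(n, k)%:R :> R.
Proof.
elim: n k => [|n IH] [|k]; rewrite ?gbinom0 ?bin0 //.
  by rewrite /gbinom big_ord_recl subrr mul0r mul0r bin0n.
by rewrite -addn1 natrD gbinom_pascal !IH addn1 binS natrD.
Qed.

Lemma gbinom_vandermonde c n k :
  gbinom (n%:R + c) k = \sum_(i < k.+1) 'C(n, i)%:R * gbinom c (k - i).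
Proof.
elim: n k => [|n IH] k.
  rewrite add0r big_ord_recl bin0 mul1r subn0 big1 ?addr0 // => i _.
  by rewrite bin0n mul0r.
case: k => [|k]; first by rewrite big_ord1 !gbinom0 bin0 mulr1.
rewrite -addn1 natrD -addrA [1 + c]addrC addrA gbinom_pascal !IH.
rewrite big_ord_recl [RHS]big_ord_recl !bin0 -addrA; congr (_ + _).
rewrite -big_split /=; apply: eq_bigr => i _.
by rewrite /bump /= !add1n addn1 binS natrD subSS mulrDl.
Qed.

Lemma multichoose_neg N n : multichoose (- N%:R) n = (-1) ^+ n * 'C(N, n)%:R :> R.
Proof.
rewrite -gbinom_nat /multichoose /gbinom mulrA; congr (_ / _).
rewrite (reindex_inj rev_ord_inj) /= (eq_bigr (fun i : 'I_n => - (N%:R - i%:R))).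
  by rewrite prodrN card_ord.
by move=> i _; rewrite natrB //= -natr1; ring.
Qed.

Lemma multichooseS b n : multichoose b n.+1 * n.+1%:R = multichoose b n * (b + n%:R).
Proof.
rewrite /multichoose /gbinom !factS natrM invfM.
rewrite big_ord_recl /= subr0.
rewrite (eq_bigr (fun i : 'I_n => b + n%:R - 1 - i%:R)); last first.
  by move=> i _; rewrite /bump /= -[n.+1]addn1 !natrD; ring.
by field; rewrite natS_neq0 fact_neq0.
Qed.

Lemma multichoose0 b : multichoose b 0 = 1.
Proof. exact: gbinom0. Qed.

Lemma multichoose_gt0 b n : 0 < b -> 0 < multichoose b n.
Proof.
move=> b0; elim: n => [|n IH]; first by rewrite multichoose0.
have : 0 < multichoose b n.+1 * n.+1%:R.
  by rewrite multichooseS mulr_gt0 // ltr_wpDr.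
by rewrite pmulr_lgt0 // ltr0n.
Qed.

(** Multiplying by the factorials turns [multichoose] into a rising factorial,
    and rising factorials concatenate. *)
Lemma multichooseD b m n :
  multichoose b (m + n) * (m + n)`!%:R
  = multichoose b m * m`!%:R * (multichoose (b + m%:R) n * n`!%:R).
Proof.
elim: n => [|n IH]; first by rewrite addn0 multichoose0 !fact0 mulr1 mulr1.
rewrite addnS !factS !natrM [LHS]mulrA multichooseS mulrAC IH.
by rewrite [multichoose _ n.+1 * _]mulrA multichooseS natrD; ring.
Qed.

End Binomials.

(** * Coefficients of products of powers of linear polynomials *)

Section LinearPowers.
Variable A : comNzRingType.

Lemma coef_linear_exp (a b : A) m k :
  ((a%:P + b *: 'X) ^+ m)`_k = a ^+ (m - k) * b ^+ k *+ 'C(m, k).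
Proof.
rewrite exprDn coef_sum.
under eq_bigr do rewrite coefMn exprZn -rmorphXn coefCM coefZ coefXn mulrA mulr_natr mulrb.
have [km|mk] := leqP k m; last first.
  rewrite big1 ?bin_small ?mulr0n // => i _.
  by rewrite (gtn_eqF (leq_ltn_trans (ltn_ord i : (i <= m)%N) mk)) mul0rn.
rewrite (bigD1 (Ordinal (km : (k < m.+1)%N))) //= eqxx big1 ?addr0 // => i.
by rewrite -val_eqE /= => /negbTE h; rewrite eq_sym h mul0rn.
Qed.

(** Homogenisation is multiplicative.  Inserting a bookkeeping variable [Z] next
    to [X] and evaluating at [Z = 1] reduces this to the product of two
    one-variable polynomials. *)
Lemma homogeneous_product (a b c d X Y : A) m l :
  (a * Y + b * X) ^+ m * (c * Y + d * X) ^+ l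
  = \sum_(n < (m + l).+1)
     ((a%:P + b *: 'X) ^+ m * (c%:P + d *: 'X) ^+ l)`_n * X ^+ n * Y ^+ (m + l - n).
Proof.
pose P := ((a * Y)%:P + (b * X) *: 'X) ^+ m * ((c * Y)%:P + (d * X) *: 'X) ^+ l.
have size_lin (p q : A) : (size (p%:P + q *: 'X)%R <= 2)%N.
  rewrite (leq_trans (size_polyD _ _)) // geq_max (leq_trans (size_polyC_leq1 _)) //=.
  by rewrite (leq_trans (size_scale_leq _ _)) // size_polyX.
have szexp (p q : A) k : (size ((p%:P + q *: 'X) ^+ k)%R <= k.+1)%N.
  rewrite (leq_trans (size_poly_exp_leq _ _)) // ltnS -[leqRHS]mul1n leq_mul2r.
  by have := size_lin p q; lia.
have szP : (size P <= (m + l).+1)%N.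
  rewrite (leq_trans (size_polyMleq _ _)) //.
  have := szexp (a * Y) (b * X) m; have := szexp (c * Y) (d * X) l; lia.
have -> : (a * Y + b * X) ^+ m * (c * Y + d * X) ^+ l = P.[1].
  by rewrite /P !hornerE.
rewrite (horner_coef_wide _ szP); apply: eq_bigr => n _.
rewrite expr1n mulr1 /P !coefM !mulr_suml; apply: eq_bigr => i _.
rewrite !coef_linear_exp !exprMn.
have [im|mi] := leqP i m; last by rewrite bin_small // !mulr0n !mul0r.
have [il|li] := leqP (n - i) l; last by rewrite (@bin_small l) // !mulr0n !(mulr0,mul0r).
have -> : (m + l - n = (m - i) + (l - (n - i)))%N by have := ltn_ord n; have := ltn_ord i; lia.
have -> : X ^+ n = X ^+ i * X ^+ (n - i) by rewrite -exprD subnKC // -ltnS.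
rewrite exprD !(mulrnAl, mulrnAr); congr (_ *+ _ *+ _); ring.
Qed.

End LinearPowers.

(** * Identities between polynomial functions *)

Section PolynomialFunctions.
Context {R : realType}.
Implicit Types f g : R -> R.

(** Functions of the real parameter that are given by a polynomial: two of them
    agree as soon as they agree at all large negative integers. *)
Definition polyfun f := exists p : {poly R}, forall x, f x = p.[x].

Lemma polyfun_cst (a : R) : polyfun (fun=> a).
Proof. by exists a%:P => x; rewrite hornerC. Qed.

Lemma polyfunM f g : polyfun f -> polyfun g -> polyfun (fun x => f x * g x).
Proof. by move=> [p fp] [q gq]; exists (p * q) => x; rewrite hornerM fp gq. Qed.

Lemma polyfun_sum n (F : 'I_n -> R -> R) :
  (forall i, polyfun (F i)) -> polyfun (fun x => \sum_(i < n) F i x).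
Proof.
move=> H; exists (\sum_(i < n) sval (cid (H i))) => x.
by rewrite horner_sum; apply: eq_bigr => i _; exact: (svalP (cid (H i))).
Qed.

Lemma polyfun_gbinom (h : R -> R) (a : R) k :
  (forall x, h x = x + a) -> polyfun (fun x => gbinom (h x) k).
Proof.
move=> ha; exists (\prod_(i < k) ('X - (i%:R - a)%:P) * (k`!%:R^-1)%:P) => x.
rewrite hornerM hornerC horner_prod /gbinom ha; congr (_ / _).
by apply: eq_bigr => i _; rewrite !hornerE; ring.
Qed.

Lemma polyfun_eq f g N0 : polyfun f -> polyfun g ->
  (forall N, (N0 <= N)%N -> f (- N%:R) = g (- N%:R)) -> forall x, f x = g x.
Proof.
move=> [p fp] [q gq] H x; rewrite fp gq; congr (_.[x]).
apply/eqP; rewrite -subr_eq0; apply/eqP.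
pose s := [seq - (N0 + i)%:R : R | i <- iota 0 (size (p - q))].
apply: (@roots_geq_poly_eq0 _ _ s); last by rewrite size_map size_iota.
  apply/allP => _ /mapP[i _ ->]; rewrite /root !hornerE -fp -gq subr_eq0.
  by apply/eqP/H; rewrite leq_addr.
rewrite map_inj_uniq ?iota_uniq // => i j /oppr_inj/eqP.
by rewrite eqr_nat eqn_add2l => /eqP.
Qed.

End PolynomialFunctions.

(** * Matrix coefficients and their products *)

Section MatrixCoefficients.
Context {R : realType}.
Implicit Types (t b c : R) (i j k l m n N : nat).

(** The coefficient of [w^n] in [(t - w)^m (1 - w)^(-b-m)], expanded. *)
Definition mcoef t b m n : R :=
  \sum_(k < n.+1)
    (-1) ^+ k * 'C(m, k)%:R * multichoose (b + m%:R) (n - k) * t ^+ (m - k).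

(** Up to the factor [(1 - t)^(2 m)], the generating function of the finite
    factor of the decomposition, translated by [m]. *)
Definition shift_poly t c m : {poly R} :=
  \sum_(l < m.+1) (gbinom c l * 'C(m, l)%:R * t ^+ l * (1 - t) ^+ (2 * (m - l)))
                    *: ('X^(m - l) * (1 - 'X) ^+ (2 * l)).

(** The coefficient [mcoef] when [- b - m] is the natural number [l].  The ring
    is arbitrary because [t] is later viewed as a constant among polynomials in
    a second variable. *)
Definition mobius_coef (A : comNzRingType) (t : A) m l n : A :=
  ((t%:P - 'X) ^+ m * (1 - 'X) ^+ l)`_n.

Lemma mobius_coef_morph (A B : comNzRingType) (f : {rmorphism A -> B}) (t : A) m l n :
  f (mobius_coef A t m l n) = mobius_coef B (f t) m l n.
Proof.
rewrite /mobius_coef -coef_map rmorphM !rmorphXn !rmorphB /= map_polyC map_polyX /=.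
by rewrite rmorph1.
Qed.

Lemma mcoef_neg t N m n : (m <= N)%N ->
  mcoef t (- N%:R) m n = mobius_coef R t m (N - m) n.
Proof.
move=> mN; rewrite /mcoef /mobius_coef coefM; apply: eq_bigr => k _.
have e (a : R) l i : ((a%:P - 'X) ^+ l)`_i = a ^+ (l - i) * (-1) ^+ i *+ 'C(l, i).
  by rewrite -(scaleN1r 'X) coef_linear_exp.
have -> : - N%:R + m%:R = - (N - m)%:R :> R by rewrite natrB // opprB addrC.
rewrite multichoose_neg e -polyC1 e expr1n mul1r -[_ *+ 'C(m, k)]mulr_natr -[_ *+ 'C(_, n - k)]mulr_natr.
by ring.
Qed.

(** Expand [C(j + c, j)] by Vandermonde; for each [l] the sum over [j] is then
    the binomial expansion of [((P - B) + B)^(m - l)]. *)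
Lemma binom_transform c m (P B : {poly R}) :
  \sum_(j < m.+1) ('C(m, j)%:R * gbinom (j%:R + c) j) *: (B ^+ j * (P - B) ^+ (m - j))
  = \sum_(l < m.+1) ('C(m, l)%:R * gbinom c l) *: (B ^+ l * P ^+ (m - l)).
Proof.
under eq_bigr => j _.
  rewrite gbinom_vandermonde (reindex_inj rev_ord_inj) /=.
  under eq_bigr => i _ do rewrite subSS bin_sub ?leq_ord // subKn ?leq_ord //.
  rewrite (big_ord_widen m.+1 (fun l => 'C(j, l)%:R * gbinom c l)) //.
  rewrite mulr_sumr scaler_suml; over.
rewrite (exchange_big_dep predT) //=; apply: eq_bigr => l _.
rewrite big_mkcond /=.
rewrite -(big_mkord xpredT (fun j => if (l < j.+1)%N then
  ('C(m, j)%:R * ('C(j, l)%:R * gbinom c l)) *: (B ^+ j * (P - B) ^+ (m - j)) else 0)).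
have lm : (l <= m)%N by rewrite -ltnS.
rewrite (big_cat_nat _ (leqW lm)) //=.
rewrite big_nat_cond big1 ?add0r; last first.
  by move=> j /andP[/andP[_ jl] _]; rewrite ltnS leqNgt jl.
rewrite -{1}[nat_of_ord l]add0n big_addn big_mkord.
have -> : P = (P - B) + B by rewrite subrK.
rewrite subSn // exprDn mulr_sumr scaler_sumr; apply: eq_bigr => i _.
rewrite ltnS leq_addl addrK.
have im : (i <= m - l)%N by rewrite -ltnS.
have bE : 'C(m, i + l)%:R * 'C(i + l, l)%:R = 'C(m, l)%:R * 'C(m - l, i)%:R :> R.
  by rewrite -!natrM addnC bin_trinomial.
rewrite mulrA bE [in RHS]mulrnAr -[(B ^+ l * _) *+ _]scaler_nat scalerA; congr (_ *: _).
  by ring.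
by rewrite exprD addnC subnDA; ring.
Qed.

(** With [u] the inner variable, [w] the outer one, [X = u (t - w)] and
    [Y = 1 - w], the homogeneous form of [(t - w)^m (1 - w)^(N - m)] evaluated at
    [(X, Y)] is expanded in two ways: monomial by monomial, where the coefficient
    of [w^m] in [(t - w)^n (1 - w)^(N - n)] produces the second factor, and after
    collecting the powers of [w] in the two linear forms [t Y - X] and [Y - X]. *)
Lemma coef_core_neg t N m n : (m + m <= N)%N -> (n <= N)%N ->
  mcoef t (- N%:R) m n * mcoef t (- N%:R) n m
  = (shift_poly t (m%:R - N%:R - 1) m * (1 - t *: 'X) ^+ (N - 2 * m))`_n.
Proof.
move=> mmN nN; have mN : (m <= N)%N by lia.
pose t2 : {poly {poly R}} := t%:P%:P.
pose u : {poly R} := 'X.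
have hom := @homogeneous_product {poly {poly R}} t2 (-1) 1 (-1)
  (u%:P * (t2 - 'X)) (1 - 'X) m (N - m).
rewrite subnKC // in hom.
have lhsE : t2 * (1 - 'X) + -1 * (u%:P * (t2 - 'X))
            = (t%:P * (1 - u))%:P + (u - t%:P) *: 'X.
  rewrite /t2 -mul_polyC !rmorphM !rmorphB /= polyC1; ring.
have lhsE' : 1 * (1 - 'X) + -1 * (u%:P * (t2 - 'X))
            = (1 - t%:P * u)%:P + (- (1 - u)) *: 'X.
  rewrite /t2 -mul_polyC !(rmorphM, rmorphB, rmorphN) /= polyC1; ring.
rewrite lhsE lhsE' in hom.
(* Extract the coefficient of [w^m], then below the one of [u^n]. *)
move/(congr1 (fun p : {poly {poly R}} => p`_m)): hom.
rewrite coef_sum.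
under [in RHS]eq_bigr => i _.
  have -> : ((t2%:P + -1 *: 'X) ^+ m * (1%:P + -1 *: 'X) ^+ (N - m))`_i
     = (mcoef t (- N%:R) m i)%:P%:P.
    rewrite !scaleN1r polyC1 mcoef_neg // -[LHS]/(mobius_coef _ t2 m (N - m) i).
    by rewrite /t2 -!mobius_coef_morph.
  have -> : (mcoef t (- N%:R) m i)%:P%:P * (u%:P * (t2 - 'X)) ^+ i * (1 - 'X) ^+ (N - i)
     = ((mcoef t (- N%:R) m i)%:P * u ^+ i) *: ((t2 - 'X) ^+ i * (1 - 'X) ^+ (N - i)).
    by rewrite exprMn -mul_polyC rmorphM rmorphXn /= !mulrA.
  rewrite coefZ -[X in _ * X]/(mobius_coef {poly R} t%:P i (N - i) m).
  rewrite -mobius_coef_morph -mcoef_neg; last by rewrite -ltnS.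
  over.
rewrite /=.
move/(congr1 (fun p : {poly R} => p`_n)).
rewrite [X in _ = X -> _]coef_sum.
rewrite (bigD1 (Ordinal (nN : (n < N.+1)%N))) //= big1 ?addr0; last first.
  move=> i; rewrite -val_eqE /= eq_sym => /negbTE ni.
  by rewrite coefMC coefCM coefXn ni mulr0 mul0r.
rewrite coefMC coefCM coefXn eqxx mulr1 => <-; apply: (congr1 (fun p : {poly R} => p`_n)).
pose c : R := m%:R - N%:R - 1.
pose B : {poly R} := t *: (1 - u) ^+ 2; pose P : {poly R} := (1 - t) ^+ 2 *: u.
(* The identity [u (1 - t)^2 - t (1 - u)^2 = (u - t) (1 - t u)] is what brings
   the sum into the shape of [binom_transform]. *)
have PB : P - B = (u - t%:P) * (1 - t%:P * u).
  rewrite /P /B -!mul_polyC !(rmorphB, rmorphXn) /= polyC1; ring.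
rewrite coefM (reindex_inj rev_ord_inj) /=.
transitivity (\sum_(j < m.+1) ('C(m, j)%:R * gbinom (j%:R + c) j)
   *: (B ^+ j * (P - B) ^+ (m - j)) * (1 - t *: u) ^+ (N - 2 * m)).
  apply: eq_bigr => j _; have jm : (j <= m)%N by rewrite -ltnS.
  rewrite subSS subKn // !coef_linear_exp bin_sub //.
  have -> : gbinom (j%:R + c) j = (-1) ^+ j * 'C(N - m, j)%:R.
    rewrite -multichoose_neg /multichoose natrB // /c; congr gbinom; ring.
  rewrite PB /B -!mul_polyC !exprMn -rmorphXn /= !(rmorphM, rmorphXn, rmorphN, rmorph_nat) /= polyC1.
  have -> : (N - m - j = (m - j) + (N - 2 * m))%N by lia.
  rewrite exprD -[- (1 - u)]mulN1r exprMn -[_ *+ 'C(m, j)]mulr_natr -[_ *+ 'C(N - m, j)]mulr_natr.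
  rewrite subKn //; ring.
rewrite -mulr_suml binom_transform /shift_poly; congr (_ * _); apply: eq_bigr => l _.
have -> : B ^+ l * P ^+ (m - l)
    = (t ^+ l * (1 - t) ^+ (2 * (m - l))) *: (u ^+ (m - l) * (1 - u) ^+ (2 * l)).
  rewrite /B /P -!mul_polyC !exprMn !rmorphM !rmorphXn /= !exprM !expr2 !exprMn.
  by ring.
by rewrite scalerA -/c; congr (_ *: _); ring.
Qed.

Lemma coef_shift_poly t c m k :
  (shift_poly t c m)`_k
  = \sum_(l < m.+1) gbinom c l * ('C(m, l)%:R * t ^+ l * (1 - t) ^+ (2 * (m - l))
       * ('X^(m - l) * (1 - 'X) ^+ (2 * l) : {poly R})`_k).
Proof. by rewrite coef_sum; apply: eq_bigr => l _; rewrite coefZ; ring. Qed.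

(** Generating function of the products of opposite coefficients; both sides are
    polynomials in [b], hence [coef_core_neg] suffices. *)
Lemma mcoef_mul t b m n :
  mcoef t b m n * mcoef t b n m
  = \sum_(k < n.+1) (shift_poly t (b + m%:R - 1) m)`_k
      * (multichoose (b + 2 * m%:R) (n - k) * t ^+ (n - k)).
Proof.
have pmc p q : polyfun (fun b => mcoef t b p q).
  apply: polyfun_sum => k; apply: polyfunM; last exact: polyfun_cst.
  apply: polyfunM; first exact: polyfun_cst.
  by apply: (@polyfun_gbinom _ _ (p%:R + (q - k)%:R - 1)) => y; ring.
move: b; apply: (@polyfun_eq _ (fun b => mcoef t b m n * mcoef t b n m)
  (fun b => \sum_(k < n.+1) (shift_poly t (b + m%:R - 1) m)`_k
      * (multichoose (b + 2 * m%:R) (n - k) * t ^+ (n - k))) (m + m + n)).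
- exact: polyfunM.
- apply: polyfun_sum => k; apply: polyfunM.
    have [p pE] : polyfun (fun b => \sum_(l < m.+1) gbinom (b + m%:R - 1) l
       * ('C(m, l)%:R * t ^+ l * (1 - t) ^+ (2 * (m - l))
       * ('X^(m - l) * (1 - 'X) ^+ (2 * l) : {poly R})`_k)).
      apply: polyfun_sum => l; apply: polyfunM; last exact: polyfun_cst.
      by apply: (@polyfun_gbinom _ _ (m%:R - 1)) => y; ring.
    by exists p => y; rewrite coef_shift_poly pE.
  apply: polyfunM; last exact: polyfun_cst.
  by apply: (@polyfun_gbinom _ _ (2 * m%:R + (n - k)%:R - 1)) => y; ring.
move=> N hN; rewrite coef_core_neg; [|lia|lia].
rewrite coefM; apply: eq_bigr => k _.
have -> : - N%:R + m%:R - 1 = m%:R - N%:R - 1 :> R by ring.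
have -> : - N%:R + 2 * m%:R = - (N - 2 * m)%:R :> R.
  by rewrite natrB ?natrM; [ring|lia].
rewrite multichoose_neg -scaleNr -polyC1 coef_linear_exp expr1n mul1r.
congr (_ * _); rewrite -[_ *+ _]mulr_natr (exprNn t); ring.
Qed.

(** Comparing term by term, [Q_d] collects the coefficient of [u^k] in
    [u^(m-l) (1 - u)^(2l)]; it is the same for [k = m - d] and [k = m + d] because
    [C(2l, l - d) = C(2l, l + d)]. *)
Lemma shift_poly_Qpoly t (nu : R) m k : t != 1 ->
  (shift_poly t (2 * nu - m%:R - 1) m)`_k
  = (1 - t) ^+ (2 * m) * Qpoly nu m `|k - m|%N (t / (1 - t) ^+ 2).
Proof.
move=> t1; have t1' : 1 - t != 0 by rewrite subr_eq0 eq_sym.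
rewrite coef_shift_poly /Qpoly; set d := `|k - m|%N; set x := t / _.
rewrite (@big_nat_widenl _ _ _ d 0%N) //= (big_mkord (fun i => d <= i)%N). rewrite !mulr_sumr [RHS]big_mkcond /=.
apply: eq_bigr => l _; have lm : (l <= m)%N by rewrite -ltnS.
rewrite coefXnM.
have tE : t ^+ l * (1 - t) ^+ (2 * (m - l)) = (1 - t) ^+ (2 * m) * x ^+ l.
  rewrite /x expr_div_n -exprM mulrCA; congr (_ * _).
  apply: (@mulIf _ ((1 - t) ^+ (2 * l))); first by rewrite expf_neq0.
  rewrite -mulrA mulVf ?expf_neq0 // mulr1 -exprD; congr (_ ^+ _); lia.
have -> : 'C(m, l)%:R * t ^+ l * (1 - t) ^+ (2 * (m - l))
   = 'C(m, l)%:R * ((1 - t) ^+ (2 * m) * x ^+ l) by rewrite -tE; ring.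
have cE i : ((1 - 'X) ^+ (2 * l) : {poly R})`_i = (-1) ^+ i * 'C(2 * l, i)%:R.
  by rewrite -scaleN1r -polyC1 coef_linear_exp expr1n mul1r -[_ *+ _]mulr_natr.
rewrite cE (exprNn x).
have dE : (d = if k <= m then m - k else k - m)%N by rewrite /d; case: leqP => ?; lia.
case: (boolP (d <= l)%N) => [dl|ld].
  have -> : (k < m - l)%N = false by apply/negbTE; move: dE; case: ifP; lia.
  have sE : (-1) ^+ (k - (m - l)) = (-1) ^+ d * (-1) ^+ l :> R.
    rewrite -exprD -signr_odd -[RHS]signr_odd; congr (_ ^+ (nat_of_bool _)).
    by move: dE; case: ifP => ? ?; lia.
  have -> : 'C(2 * l, k - (m - l)) = 'C(2 * l, l - d).
    move: dE; case: ifPn => km dE; first by congr ('C(_, _)); lia.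
    by rewrite -bin_sub; [congr ('C(_, _))|]; lia.
  by rewrite sE; ring.
case: ifPn => kml; first by rewrite !mulr0.
rewrite (@bin_small (2 * l)) ?mulr0 //.
by move: dE; case: ifP; lia.
Qed.

End MatrixCoefficients.

(** * Matrix coefficients as Jacobi polynomials *)

Section JacobiMatrixCoefficients.
Context {R : realType}.
Implicit Types (t b : R) (k l m n : nat).

(** Expanding the powers of [1 - t] and summing by Vandermonde turns the
    definition of the Jacobi polynomial into its expansion in powers of [t]. *)
Lemma jacobi_multichoose t b m n : (m <= n)%N ->
  jacobi m (n - m)%:R (b - 1) (1 - 2 * t)
  = (-1) ^+ m * \sum_(k < m.+1)
      (-1) ^+ k * 'C(n, k)%:R * multichoose (b + n%:R) (m - k) * t ^+ (m - k).
Proof.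
move=> mn; rewrite /jacobi.
have -> : m%:R + (n - m)%:R = n%:R :> R by rewrite -natrD subnKC.
have -> : (1 - 2 * t - 1) / 2 = - t by field.
have -> : (1 - 2 * t + 1) / 2 = - t + 1 by field.
pose g i := gbinom (m%:R + (b - 1)) i.
transitivity (\sum_(k < m.+1) \sum_(l < m.+1)
   ('C(n, k) * 'C(k, l))%:R * g (m - k)%N * (- t) ^+ (m - l)).
  apply: eq_bigr => k _; have km : (k <= m)%N by rewrite -ltnS.
  rewrite gbinom_nat exprDn mulr_sumr.
  rewrite (big_ord_widen m.+1 (fun l => 'C(n, k)%:R * g (m - k)%N * (- t) ^+ (m - k)
     * ((- t) ^+ (k - l) * 1 ^+ l *+ 'C(k, l)))) // big_mkcond /=.
  apply: eq_bigr => l _; case: ifPn => [lk|]; last first.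
    by rewrite -leqNgt => /bin_small ->; rewrite muln0 !mul0r.
  rewrite ltnS in lk.
  have -> : (m - l = (m - k) + (k - l))%N by lia.
  by rewrite exprD expr1n -[_ *+ 'C(k, l)]mulr_natr natrM; ring.
rewrite exchange_big /= mulr_sumr; apply: eq_bigr => l _.
have lm : (l <= m)%N by rewrite -ltnS.
rewrite -mulr_suml.
have -> : \sum_(k < m.+1) ('C(n, k) * 'C(k, l))%:R * g (m - k)%N
   = 'C(n, l)%:R * multichoose (b + n%:R) (m - l).
  rewrite -(big_mkord xpredT (fun k => ('C(n, k) * 'C(k, l))%:R * g (m - k)%N)).
  rewrite (big_cat_nat _ (leqW lm)) //= big_nat_cond big1 ?add0r; last first.
    by move=> j /andP[/andP[_ jl] _]; rewrite (bin_small jl) muln0 mul0r.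
  rewrite -{1}[nat_of_ord l]add0n big_addn big_mkord subSn //.
  have -> : multichoose (b + n%:R) (m - l) = gbinom ((n - l)%:R + (m%:R + (b - 1))) (m - l).
    rewrite /multichoose !natrB //; last exact: leq_trans mn.
    by congr gbinom; ring.
  rewrite gbinom_vandermonde mulr_sumr; apply: eq_bigr => i _.
  by rewrite [(i + l)%N]addnC bin_trinomial natrM subnDA /g; ring.
have -> : (-1) ^+ m = (-1) ^+ (m - l) * (-1) ^+ l :> R by rewrite -exprD subnK.
have ll : (-1) ^+ l * (-1) ^+ l = 1 :> R by rewrite -exprD -signr_odd oddD addbb.
rewrite (exprNn t) -[LHS]mul1r -[X in X * _]ll; ring.
Qed.

Lemma mcoef_ge t b m n : (m <= n)%N ->
  mcoef t b n m
  = (-1) ^+ m * t ^+ (n - m) * jacobi m (n - m)%:R (b - 1) (1 - 2 * t).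
Proof.
move=> mn; rewrite jacobi_multichoose // /mcoef mulrACA -!expr2 sqrr_sign.
rewrite mul1r mulr_sumr; apply: eq_bigr => k _.
have km : (k <= m)%N by rewrite -ltnS.
have -> : (n - k = (n - m) + (m - k))%N by lia.
by rewrite exprD; ring.
Qed.

(** Both sides are the multinomial-like quotient of the rising factorial of
    length [m + n - k] by [k! (m - k)! (n - k)!], which is symmetric in [m] and
    [n]: this is the unitarity of the representation. *)
Lemma multichoose_binomial_sym b m n k : (k <= m)%N -> (m <= n)%N ->
  multichoose b m * ('C(m, k)%:R * multichoose (b + m%:R) (n - k))
  = multichoose b n * ('C(n, k)%:R * multichoose (b + n%:R) (m - k)).
Proof.
move=> km mn; have kn := leq_trans km mn.
have hm := multichooseD b m (n - k); have hn := multichooseD b n (m - k).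
have e : (m + (n - k) = n + (m - k))%N by lia.
rewrite e hn -(bin_fact km) -(bin_fact kn) !natrM in hm.
have nz i : i`!%:R != 0 :> R by rewrite pnatr_eq0 -lt0n fact_gt0.
apply: (mulIf (mulf_neq0 (nz k) (mulf_neq0 (nz (m - k)%N) (nz (n - k)%N)))).
transitivity (multichoose b m * ('C(m, k)%:R * (k`!%:R * (m - k)`!%:R)) *
       (multichoose (b + m%:R) (n - k) * (n - k)`!%:R)); first by ring.
by rewrite -hm; ring.
Qed.

(** The companion of [mcoef_ge] under the exchange of the indices; no power of [t]
    appears, so that [t = 0] needs no separate treatment. *)
Lemma mcoef_le t b m n : (m <= n)%N ->
  multichoose b m * mcoef t b m n
  = (-1) ^+ m * multichoose b n * jacobi m (n - m)%:R (b - 1) (1 - 2 * t).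
Proof.
move=> mn; rewrite jacobi_multichoose // /mcoef.
rewrite [RHS]mulrACA -!expr2 sqrr_sign.
rewrite mul1r !mulr_sumr.
rewrite (big_ord_widen n.+1 (fun k => multichoose b n * ((-1) ^+ k * 'C(n, k)%:R *
    multichoose (b + n%:R) (m - k) * t ^+ (m - k)))) // [RHS]big_mkcond /=.
apply: eq_bigr => k _; rewrite ltnS; case: ifPn => [km|]; last first.
  by rewrite -ltnNge => /bin_small ->; rewrite mulr0 !mul0r mulr0.
transitivity ((-1) ^+ k * t ^+ (m - k) *
  (multichoose b m * ('C(m, k)%:R * multichoose (b + m%:R) (n - k)))); first by ring.
by rewrite multichoose_binomial_sym //; ring.
Qed.

End JacobiMatrixCoefficients.

(** * The Gamma function *)

Section GammaDensity.
Context {R : realType}.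
Implicit Types (a t : R).

Definition gamma_density a t : R := t `^ a * expR (- t).

Lemma gamma_density_ge0 a t : 0 <= gamma_density a t.
Proof. by rewrite mulr_ge0 ?powR_ge0 ?expR_ge0. Qed.

Lemma measurable_gamma_density a : measurable_fun [set: R] (gamma_density a).
Proof.
apply: measurable_funM; first exact: measurable_powR.
by apply: measurableT_comp => //; exact: measurable_expR.
Qed.

(** One bound serves twice: it gives the decay at infinity and the convergence of
    the integral. *)
Lemma gamma_density_le a : 0 <= a ->
  exists C : R, 0 <= C /\ forall t, 0 < t -> gamma_density a t <= C * expR (- (2^-1 * t)).
Proof.
move=> a0; set n := (Num.truncn a).+1.
exists (n`!%:R * 2 ^+ n * expR (2^-1)); split.
  by rewrite !mulr_ge0 ?expR_ge0 ?exprn_ge0.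
move=> t t0; have t1 : 1 <= t + 1 by rewrite lerDr ltW.
have h1 : t `^ a <= (t + 1) ^+ n.
  apply: (@le_trans _ _ ((t + 1) `^ a)).
    by apply: ge0_ler_powR; rewrite ?nnegrE ?lerDl ?addr_ge0 ?(ltW t0).
  rewrite -powR_mulrn ?ler_powR//; last by rewrite ltW// (lt_le_trans _ t1).
  by rewrite ltW// /n truncnS_gt.
have h2 : (2^-1 * (t + 1)) ^+ n / n`!%:R <= expR (2^-1 * (t + 1)).
  have := @expR_ge1Dxn R (2^-1 * (t + 1)) (Num.truncn a).
  rewrite -/n => h; rewrite (le_trans _ (h _)) ?lerDr// mulr_ge0 // (le_trans _ t1) //.
have h3 : (t + 1) ^+ n <= n`!%:R * 2 ^+ n * expR (2^-1 * (t + 1)).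
  have -> : (t + 1) ^+ n = n`!%:R * 2 ^+ n * ((2^-1 * (t + 1)) ^+ n / n`!%:R).
    rewrite exprMn exprVn; field.
    by rewrite expf_neq0 // pnatr_eq0 -lt0n fact_gt0.
  by rewrite ler_wpM2l // mulr_ge0 // exprn_ge0.
rewrite /gamma_density (le_trans (ler_wpM2r (expR_ge0 _) (le_trans h1 h3))) //.
rewrite -!mulrA -!expRD.
have -> : 2^-1 * (t + 1) - t = 2^-1 - 2^-1 * t by field.
exact: lexx.
Qed.

Lemma cvg_gamma_densityy a : 0 <= a -> gamma_density a t @[t --> +oo] --> 0.
Proof.
move=> a0; have [C [C0 hC]] := gamma_density_le a a0.
apply: (@squeeze_cvgr _ _ _ _ (cst 0) (fun t => C * expR (- (2^-1 * t)))).
- near=> t; have t0 : 0 < t by near: t; exact: nbhs_pinfty_gt.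
  by rewrite gamma_density_ge0 /= hC.
- exact: cvg_cst.
rewrite -[X in _ --> X](mulr0 C); apply: cvgM; first exact: cvg_cst.
apply: (@cvg_comp _ _ _ (fun t => 2^-1 * t) (fun z => expR (- z)) _ +oo); last exact: cvgr_expR.
exact: gt0_cvgMry.
Unshelve. all: by end_near. Qed.

Lemma cvg_gamma_density0 a : 0 <= a ->
  gamma_density a t @[t --> 0^'+] --> gamma_density a 0.
Proof.
move=> a0; apply: cvgM; last first.
  apply/cvg_at_right_filter; apply: continuous_comp; last exact: continuous_expR.
  exact: (@continuousN _ R^o).
have [->|an0] := eqVneq a 0.
  by rewrite powRr0; under eq_fun do rewrite powRr0; exact: cvg_cst.
by rewrite powR0 //; apply: powR_cvg0; rewrite lt_neqAle eq_sym an0.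
Qed.

Lemma is_derive_gamma_density a t : 0 < t ->
  is_derive t 1 (gamma_density a) (a * gamma_density (a - 1) t - gamma_density a t).
Proof.
move=> t0.
have h := is_derive1_powR a t0.
have h1 : is_derive t 1 (-%R : R -> R) (-1) by apply: is_deriveN.
have h2 := is_derive1_comp (is_derive_expR (- t)) h1.
apply: is_derive_eq (is_deriveM h h2) _.
by rewrite /gamma_density /= /GRing.scale /=; ring.
Qed.

End GammaDensity.

Section GammaIntegral.
Context {R : realType}.
Implicit Types (a b t : R).
Local Notation mu := (@lebesgue_measure R).
Local Notation halfline := (`]0%R, +oo[%classic : set R).
Local Open Scope ereal_scope.

Definition gamma_integral a : \bar R := \int[mu]_(t in halfline) (gamma_density a t)%:E.

Lemma Gamma_gamma_integral a : Gamma a = fine (gamma_integral (a - 1)).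
Proof. by []. Qed.

Lemma gamma_integral_split a b : (0 < b)%R ->
  gamma_integral a = \int[mu]_(t in `[0%R, b]) (gamma_density a t)%:E
                   + \int[mu]_(t in `[b, +oo[) (gamma_density a t)%:E.
Proof.
move=> b0.
have mg (D : set R) : measurable_fun D (EFin \o gamma_density a).
  by apply: measurable_funTS; apply/measurable_EFinP; exact: measurable_gamma_density.
rewrite /gamma_integral.
rewrite -[X in X + _]integral_itv_obnd_cbnd; last exact: mg.
rewrite -[X in _ + X]integral_itv_obnd_cbnd; last exact: mg.
rewrite (@itv_bndbnd_setU _ _ _ (BRight b)) ?bnd_simp ?ltW //.
apply: ge0_integral_setU => //.
- exact: mg.
- by move=> t _; rewrite lee_fin gamma_density_ge0.
apply/disj_setPS => t /= []; rewrite !in_itv /= andbT => /andP[_ tb] bt.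
by have := le_lt_trans tb bt; rewrite ltxx.
Qed.

(** The density [t^a e^(-t)] has derivative [(a - t) t^(a-1) e^(-t)], which changes
    sign at [a] only.  Applying the fundamental theorem of calculus on [[0, a]] and
    on [[a, +oo[] separately keeps all integrands nonnegative, so no integrability
    has to be known beforehand; the two boundary terms at [a] cancel. *)
Lemma gamma_integral_rec a : (1 <= a)%R ->
  gamma_integral a = a%:E * gamma_integral (a - 1).
Proof.
move=> a1; have a0 : (0 < a)%R by rewrite (lt_le_trans _ a1).
have a10 : (0 <= a - 1)%R by rewrite subr_ge0.
have mg c (D : set R) : measurable_fun D (EFin \o gamma_density c).
  by apply: measurable_funTS; apply/measurable_EFinP; exact: measurable_gamma_density.
pose f t := (a * gamma_density (a - 1) t - gamma_density a t)%R.
have fE t : (0 <= t)%R -> f t = ((a - t) * gamma_density (a - 1) t)%R.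
  by move=> t0; rewrite /f /gamma_density -(mulr_powRB1 t0 a0); ring.
have dF t : (0 < t)%R -> derivable (gamma_density a) t 1.
  by move=> t0; have [] := is_derive_gamma_density a t t0.
have F't t : (0 < t)%R -> ((gamma_density a)^`() t = f t)%classic.
  by move=> t0; rewrite derive1E; have [_ ->] := is_derive_gamma_density a t t0.
have cg c t : (0 < t)%R -> {for t, continuous (gamma_density c)}.
  move=> t0; apply: differentiable_continuous; apply/derivable1_diffP.
  by have [] := is_derive_gamma_density c t t0.
have cf t : (0 < t)%R -> {for t, continuous f}.
  by move=> t0; apply: cvgB; [apply: cvgM; [exact: cvg_cst|]|]; exact: cg.
have F0 : gamma_density a 0 = 0%R.
  by rewrite /gamma_density powR0 ?gt_eqF // mul0r.
have left : \int[mu]_(t in `[0%R, a]) (f t)%:E = (gamma_density a a)%:E.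
  rewrite (@continuous_FTC2 _ f (gamma_density a)) ?F0 ?sube0 //.
  - apply/continuous_within_itvP => //; split.
    + by move=> t; rewrite in_itv /= => /andP[t0 _]; exact: cf.
    + apply: cvgB; last by apply: cvg_gamma_density0; rewrite ltW.
      by apply: cvgM; [exact: cvg_cst|exact: cvg_gamma_density0].
    + by apply: cvg_at_left_filter; exact: cf.
  - split.
    + by move=> t; rewrite in_itv /= => /andP[t0 _]; exact: dF.
    + by apply: cvg_gamma_density0; rewrite ltW.
    + by apply: cvg_at_left_filter; exact: cg.
  - by move=> t; rewrite in_itv /= => /andP[t0 _]; exact: F't.
have right : \int[mu]_(t in `[a, +oo[) (- f t)%:E = (gamma_density a a)%:E.
  rewrite (@ge0_continuous_FTC2y _ (fun t => - f t)%R (fun t => - gamma_density a t)%R _ 0).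
  - by rewrite sub0e EFinN oppeK.
  - move=> t at_; have t0 := le_trans (ltW a0) at_.
    by rewrite fE // -mulNr mulr_ge0 ?gamma_density_ge0 // opprB subr_ge0.
  - apply/continuous_within_itvcyP; split.
      move=> t; rewrite in_itv /= andbT => at_; apply: cvgN; apply: cf.
      exact: lt_trans at_.
    by apply: cvg_at_right_filter; apply: cvgN; exact: cf.
  - by rewrite -oppr0; apply: cvgN; apply: cvg_gamma_densityy; rewrite ltW.
  - by move=> t at_; apply: derivableN; apply: dF; exact: lt_trans at_.
  - by apply: cvg_at_right_filter; apply: cvgN; exact: cg.
  - move=> t; rewrite in_itv /= andbT => at_; have t0 := lt_trans a0 at_.
    by rewrite derive1E deriveN; [rewrite -derive1E F't|exact: dF].
have mh (D : set R) : measurable_fun D (fun t => (a * gamma_density (a - 1) t)%:E).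
  apply/measurable_EFinP; apply: measurable_funM => //.
  by apply: measurable_funTS; exact: measurable_gamma_density.
have mf (D : set R) : measurable_fun D (EFin \o f).
  apply/measurable_EFinP; apply: measurable_funB.
    by apply/measurable_EFinP; exact: mh.
  by apply/measurable_EFinP; exact: mg.
have h_ge0 t : 0 <= (a * gamma_density (a - 1) t)%:E.
  by rewrite lee_fin mulr_ge0 ?gamma_density_ge0 // ltW.
have scale (D : set R) : measurable D ->
    \int[mu]_(t in D) (a * gamma_density (a - 1) t)%:E
    = a%:E * \int[mu]_(t in D) (gamma_density (a - 1) t)%:E.
  move=> mD; rewrite -ge0_integralZl //; first exact: mg.
    by move=> t _; rewrite lee_fin gamma_density_ge0.
  by rewrite lee_fin ltW.
have left2 : a%:E * \int[mu]_(t in `[0%R, a]) (gamma_density (a - 1) t)%:E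
    = \int[mu]_(t in `[0%R, a]) (gamma_density a t)%:E + (gamma_density a a)%:E.
  rewrite -left -scale // -ge0_integralD //.
  - by apply: eq_integral => t _; rewrite -EFinD /f; congr EFin; ring.
  - by move=> t _; rewrite lee_fin gamma_density_ge0.
  - exact: mg.
  - move=> t /=; rewrite in_itv /= => /andP[t0 ta].
    by rewrite lee_fin fE // mulr_ge0 ?gamma_density_ge0 // subr_ge0.
  - exact: mf.
have right2 : \int[mu]_(t in `[a, +oo[) (gamma_density a t)%:E
    = a%:E * \int[mu]_(t in `[a, +oo[) (gamma_density (a - 1) t)%:E + (gamma_density a a)%:E.
  rewrite -right -scale // -ge0_integralD //.
  - by apply: eq_integral => t _; rewrite -EFinD /f; congr EFin; ring.
  - exact: mh.
  - move=> t /=; rewrite in_itv /= andbT => at_.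
    have t0 := le_trans (ltW a0) at_.
    by rewrite lee_fin fE // -mulNr mulr_ge0 ?gamma_density_ge0 // opprB subr_ge0.
  - by apply/measurable_EFinP; apply: measurable_funN; apply/measurable_EFinP; exact: mf.
rewrite (gamma_integral_split a a) // (gamma_integral_split (a - 1) a) // right2 addeA.
rewrite addeAC -left2 -ge0_muleDr //.
all: by apply: integral_ge0 => t _; rewrite lee_fin gamma_density_ge0.
Qed.

Lemma gamma_integral_lty a : (0 <= a)%R -> gamma_integral a < +oo.
Proof.
move=> a0; have [C [C0 hC]] := gamma_density_le a a0.
have c0 : (0 < 2^-1 :> R)%R by [].
have mp : measurable_fun halfline (fun t => (2 * C * exponential_pdf 2^-1 t)%:E).
  apply/measurable_EFinP; apply: measurable_funM => //.
  by apply: measurable_funTS; exact: measurable_exponential_pdf.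
apply: (@le_lt_trans _ _ (\int[mu]_(t in halfline) (2 * C * exponential_pdf 2^-1 t)%:E)).
  apply: ge0_le_integral => //.
  - by move=> t _; rewrite lee_fin gamma_density_ge0.
  - by apply/measurable_EFinP; apply: measurable_funTS; exact: measurable_gamma_density.
  - move=> t /=; rewrite in_itv /= andbT => t0; rewrite lee_fin.
    rewrite (exponential_pdfE _ (ltW t0)) (le_trans (hC t t0)) // mulNr.
    by rewrite [leRHS]mulrACA mulfV ?mul1r // pnatr_eq0.
apply: (@le_lt_trans _ _ (\int[mu]_t ((2 * C)%:E * (exponential_pdf 2^-1 t)%:E))).
  apply: ge0_subset_integral => //.
    apply/measurable_EFinP; apply: measurable_funM => //.
    exact: measurable_exponential_pdf.
  by move=> t _; rewrite lee_fin !mulr_ge0 // exponential_pdf_ge0 // ltW.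
rewrite ge0_integralZl //.
- by rewrite integral_exponential_pdf // mule1 ltry.
- by apply/measurable_EFinP; exact: measurable_exponential_pdf.
- by move=> t _; rewrite lee_fin exponential_pdf_ge0 // ltW.
- by rewrite lee_fin mulr_ge0.
Qed.

(** The density is at least [e^(-2)] on [[1, 2]]. *)
Lemma gamma_integral_gt0 a : (0 <= a)%R -> 0 < gamma_integral a.
Proof.
move=> a0.
apply: (@lt_le_trans _ _ (\int[mu]_(t in `[1%R, 2%R]) (expR (- 2))%:E)).
  rewrite integral_cst //= lebesgue_measure_itv /= lte_fin ltr1n -EFinB -EFinM lte_fin.
  by rewrite mulr_gt0 ?expR_gt0 // subr_gt0 ltr1n.
apply: (@le_trans _ _ (\int[mu]_(t in `[1%R, 2%R]) (gamma_density a t)%:E)).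
  apply: ge0_le_integral => //.
  - by apply/measurable_EFinP; apply: measurable_funTS; exact: measurable_gamma_density.
  - move=> t /=; rewrite in_itv /= => /andP[t1 t2]; rewrite lee_fin /gamma_density.
    rewrite -[X in (X <= _)%R]mul1r ler_pM ?expR_ge0 //.
      by rewrite -(powRr0 t) ler_powR.
    by rewrite ler_expR lerN2.
apply: ge0_subset_integral => //.
- by apply/measurable_EFinP; apply: measurable_funTS; exact: measurable_gamma_density.
- by move=> t _; rewrite lee_fin gamma_density_ge0.
by move=> t /=; rewrite !in_itv /= andbT => /andP[t1 _]; rewrite (lt_le_trans _ t1).
Qed.

End GammaIntegral.

Section GammaFunction.
Context {R : realType}.
Implicit Types a : R.

Lemma Gamma_gt0 a : 1 <= a -> 0 < Gamma a.
Proof.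
move=> a1; have a0 : 0 <= a - 1 by rewrite subr_ge0.
by rewrite Gamma_gamma_integral fine_gt0 // gamma_integral_gt0 // gamma_integral_lty.
Qed.

Lemma GammaS a : 1 <= a -> Gamma (a + 1) = a * Gamma a.
Proof.
move=> a1; have a0 : 0 <= a - 1 by rewrite subr_ge0.
rewrite !Gamma_gamma_integral addrK gamma_integral_rec // fineM //.
by rewrite ge0_fin_numE ?gamma_integral_lty // ltW // gamma_integral_gt0.
Qed.

End GammaFunction.

(** * The masses of the generalized distribution *)

Section NegativeBinomialConvolution.
Context {R : realType}.
Implicit Types (a nu t : R) (j k m n : nat).

Lemma Gamma_multichoose a n : 1 <= a ->
  Gamma (a + n%:R) = Gamma a * (multichoose a n * n`!%:R).
Proof.
move=> a1; elim: n => [|n IH]; first by rewrite addr0 multichoose0 fact0 !mulr1.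
have an : 1 <= a + n%:R by rewrite (le_trans a1) // lerDl.
rewrite -natr1 addrA GammaS // IH factS natrM [multichoose a n.+1 * _]mulrA.
by rewrite multichooseS; ring.
Qed.

(** The square of the Jacobi polynomial splits into the two opposite matrix
    coefficients; the Gamma quotient is the ratio of their normalisations. *)
Lemma gnbd_mcoef nu t m n : 1 <= 2 * nu - 2 * m%:R ->
  gnbd nu t m n = (1 - t) `^ (2 * nu - 2 * m%:R)
    * (mcoef t (2 * nu - 2 * m%:R) m n * mcoef t (2 * nu - 2 * m%:R) n m).
Proof.
set b := 2 * nu - _ => b1; have b0 : 0 < b by rewrite (lt_le_trans _ b1).
rewrite /gnbd -/b.
have -> : gnbd_coef nu m n = if (n <= m)%N then multichoose b m / multichoose b n
                             else multichoose b n / multichoose b m.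
  have bm : 2 * nu - m%:R = b + m%:R by rewrite /b; ring.
  rewrite /gnbd_coef -/b bm !Gamma_multichoose //.
  have nz i : i`!%:R != 0 :> R by rewrite pnatr_eq0 -lt0n fact_gt0.
  have mz i : multichoose b i != 0 by rewrite gt_eqF // multichoose_gt0.
  have gz : Gamma b != 0 by rewrite gt_eqF // Gamma_gt0.
  by case: ifP => _; field; rewrite !nz !mz gz.
have mz i : multichoose b i != 0 by rewrite gt_eqF // multichoose_gt0.
rewrite -[RHS]mulrC -[X in X * _ * _]mulrC.
case: ifPn => [nm|]; last rewrite -ltnNge => /ltnW mn.
  have -> : `|m - n|%N = (m - n)%N by lia.
  rewrite (minn_idPr nm) mcoef_ge //.
  have -> : mcoef t b n m = (multichoose b n)^-1 * ((-1) ^+ n * multichoose b m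
      * jacobi n (m - n)%:R (b - 1) (1 - 2 * t)) by rewrite -mcoef_le // mulKf.
  have s : (-1) ^+ n * (-1) ^+ n = 1 :> R by rewrite -expr2 sqrr_sign.
  by rewrite -[LHS]mul1r -[X in X * _]s; ring.
have -> : `|m - n|%N = (n - m)%N by lia.
rewrite (minn_idPl mn) (mcoef_ge t b m n) //.
have -> : mcoef t b m n = (multichoose b m)^-1 * ((-1) ^+ m * multichoose b n
    * jacobi m (n - m)%:R (b - 1) (1 - 2 * t)) by rewrite -mcoef_le // mulKf.
have s : (-1) ^+ m * (-1) ^+ m = 1 :> R by rewrite -expr2 sqrr_sign.
by rewrite -[LHS]mul1r -[X in X * _]s; ring.
Qed.

Lemma gnbd0_multichoose nu t n : 1 <= 2 * nu ->
  gnbd nu t 0 n = (1 - t) `^ (2 * nu) * (multichoose (2 * nu) n * t ^+ n).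
Proof.
move=> nu1; rewrite gnbd0E Gamma_multichoose //.
have gz : Gamma (2 * nu) != 0 by rewrite gt_eqF // Gamma_gt0.
have nz : n`!%:R != 0 :> R by rewrite pnatr_eq0 -lt0n fact_gt0.
by field; rewrite gz nz.
Qed.

(** The decomposition at the level of masses: the [k]-th atom of the finite factor
    sits at [k]. *)
Lemma gnbd_convolution nu t m n : 1 <= 2 * nu - 2 * m%:R -> t < 1 ->
  gnbd nu t m n
  = \sum_(k < n.+1) Qpoly nu m `|k - m|%N (t / (1 - t) ^+ 2) * gnbd nu t 0 (n - k).
Proof.
move=> b1 t1; have nu1 : 1 <= 2 * nu by rewrite (le_trans b1) // gerBl mulr_ge0.
have t1' : 1 - t != 0 by rewrite subr_eq0 gt_eqF.
rewrite gnbd_mcoef // mcoef_mul mulr_sumr; apply: eq_bigr => k _.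
have -> : 2 * nu - 2 * m%:R + m%:R - 1 = 2 * nu - m%:R - 1 by ring.
have -> : 2 * nu - 2 * m%:R + 2 * m%:R = 2 * nu by ring.
rewrite shift_poly_Qpoly ?lt_eqF // gnbd0_multichoose //.
have -> : (1 - t) `^ (2 * nu) = (1 - t) `^ (2 * nu - 2 * m%:R) * (1 - t) ^+ (2 * m).
  rewrite -powR_mulrn; last by rewrite subr_ge0 ltW.
  by rewrite -powRD ?t1' ?implybT // natrM subrK.
ring.
Qed.

End NegativeBinomialConvolution.

(** * Convolution with a finite combination of Dirac masses *)

Section FiniteCombinationConvolution.
Context {R : realType}.
Local Notation T := (measurableTypeR R).
Local Open Scope ereal_scope.
Implicit Types (A : set T) (a r : R).

Definition translate a A : set T := (fun x : T => (x + a)%R : T) @^-1` A.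

Lemma measurable_translate a A : measurable A -> measurable (translate a A).
Proof.
move=> mA; rewrite -[X in measurable X]setTI.
by apply: (measurable_funD (@measurable_id _ _ _) (measurable_cst a)).
Qed.

Lemma measurable_sum_preimage A : measurable A ->
  measurable ((fun xy : T * T => (xy.1 + xy.2)%R : T) @^-1` A).
Proof.
move=> mA; rewrite -[X in measurable X]setTI.
by apply: (measurable_funD (@measurable_fst _ _ _ _) (@measurable_snd _ _ _ _)).
Qed.

Lemma mconvE (M N : {finite_measure set T -> \bar R}) A :
  mconv M N A = \int[M]_x N (translate x A).
Proof.
rewrite /mconv /pushforward /product_measure1 /=; apply: eq_integral => x _ /=.
congr (N _); apply/seteqP; split => y; rewrite /translate /=.
  by move/xsectionP => /=; rewrite addrC.
by move=> h; apply/xsectionP => /=; rewrite addrC.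
Qed.

Lemma integrable_translate (M N : {finite_measure set T -> \bar R}) A :
  measurable A -> M.-integrable [set: T] (fun x => N (translate x A)).
Proof.
move=> mA; apply/integrableP; split.
  have := measurable_fun_xsection N (measurable_sum_preimage A mA).
  apply: eq_measurable_fun => x _ /=; congr (N _).
  apply/seteqP; split => y; rewrite /translate /=.
    by move/xsectionP => /=; rewrite addrC.
  by move=> h; apply/xsectionP => /=; rewrite addrC.
under eq_integral do rewrite gee0_abs //.
rewrite -mconvE -ge0_fin_numE ?measure_ge0 //.
exact: fin_num_measure.
Qed.

(** By construction of the product measure, [mconv M N A] integrates against [M] the [N]-measure of the translates
    of [A]; for [N1 - N2] a combination of Dirac masses the integrand becomes a
    combination of indicator functions. *)
Lemma mconv_finite_combination (M N1 N2 : {finite_measure set T -> \bar R})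
    n (c a : 'I_n -> R) :
  (forall B, measurable B -> N1 B - N2 B = \sum_(i < n) (c i)%:E * \d_(a i : T) B) ->
  forall A, measurable A ->
  mconv M N1 A - mconv M N2 A = \sum_(i < n) (c i)%:E * M (translate (a i) A).
Proof.
move=> H A mA; rewrite !mconvE -integralB //; [|exact: integrable_translate..].
have E x : N1 (translate x A) - N2 (translate x A)
     = \sum_(i < n) (c i)%:E * (\1_(translate (a i) A) x)%:E.
  rewrite H; last exact: measurable_translate.
  apply: eq_bigr => i _; rewrite diracE indicE; congr (_ * (nat_of_bool _)%:R%:E).
  by apply/idP/idP; rewrite !inE /translate /= addrC.
under eq_integral do rewrite E.
have ii i : M.-integrable [set: T] (fun x => (\1_(translate (a i) A) x)%:E).
  by apply: integrable_indic; exact: measurable_translate.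
rewrite integral_sum //; last by move=> i; exact: integrableZl.
apply: eq_bigr => i _; rewrite integralZl // integral_indic ?setIT //.
exact: measurable_translate.
Qed.

(** Grouping the four terms of the definition by the Jordan parts of [mu], the Jordan
    parts of [nu] enter only through their difference, which is [nu] itself; so the
    Hahn decomposition of [nu] never has to be computed. *)
Lemma charge_conv_finite_combination (mu nu : {charge set T -> \bar R})
    n (c a : 'I_n -> R) :
  (forall B, measurable B -> nu B = \sum_(i < n) (c i)%:E * \d_(a i : T) B) ->
  forall A, measurable A ->
  charge_conv mu nu A = \sum_(i < n) (c i)%:E * mu (translate (a i) A).
Proof.
move=> H A mA.
have part (ka : {charge set T -> \bar R}) B : measurable B ->
    ka B = pos_part ka B - neg_part ka B.
  by move=> mB; rewrite (jordan_decomp (hahnP ka) mB) /cadd /= cscaleN1.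
have nuE B : measurable B ->
    pos_part nu B - neg_part nu B = \sum_(i < n) (c i)%:E * \d_(a i : T) B.
  by move=> mB; rewrite -part // H.
have P1 := mconv_finite_combination (pos_part mu) _ _ _ c a nuE A mA.
have P2 := mconv_finite_combination (neg_part mu) _ _ _ c a nuE A mA.
have -> : charge_conv mu nu A =
    (mconv (pos_part mu) (pos_part nu) A - mconv (pos_part mu) (neg_part nu) A)
    - (mconv (neg_part mu) (pos_part nu) A - mconv (neg_part mu) (neg_part nu) A).
  rewrite /charge_conv /cadd /copp /charge_of_finite_measure /=.
  have fin (M N : {finite_measure set T -> \bar R}) : mconv M N A \is a fin_num.
    exact: fin_num_measure.
  have fin_rearrange (x y z w : \bar R) : x \is a fin_num -> y \is a fin_num ->
      z \is a fin_num -> w \is a fin_num -> (x + y) - (z + w) = (x - z) - (w - y).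
    case: x => // x; case: y => // y; case: z => // z; case: w => // w _ _ _ _.
    by rewrite -!(EFinN, EFinD); congr EFin; ring.
  by apply: fin_rearrange; exact: fin.
rewrite P1 P2 -sumeN; last first.
  move=> i j _ _; rewrite fin_num_adde_defl // fin_numM // fin_num_measure //.
  exact: measurable_translate.
rewrite -big_split /=; apply: eq_bigr => i _.
rewrite (part mu); last exact: measurable_translate.
rewrite muleBr // fin_num_adde_defr // fin_num_measure //.
exact: measurable_translate.
Qed.

End FiniteCombinationConvolution.

(** * Measures carried by the natural numbers *)

Section AtomicMeasures.
Context {R : realType}.
Local Notation T := (measurableTypeR R).
Implicit Types (p q f : nat -> R) (A : set T).

Definition atom_series p A : nat -> R := series (fun j => p j * ((j%:R : T) \in A)%:R).

Lemma atomic_cvg p A (l : R) : atom_series p A @ \oo --> l -> atomic p A = l%:E.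
Proof.
move=> pl; rewrite /atomic.
have -> : (fun n => \sum_(0 <= j < n) (p j)%:E * \d_(j%:R : T) A)%E
          = EFin \o atom_series p A.
  apply/funext => n; rewrite /atom_series /series /= -sumEFin.
  by apply: eq_bigr => j _; rewrite diracE.
rewrite EFin_lim; last by apply/cvg_ex; exists l.
by congr EFin; exact/cvg_lim.
Qed.

Lemma is_cvg_atom_series p A :
  summable [set: nat] (EFin \o p) -> cvgn (atom_series p A).
Proof.
move=> sp; apply: normed_cvg.
have h : cvgn (series (fun j => `|p j|)).
  have := @summable_cvg R xpredT (abse \o (EFin \o p)).
  apply => [i _|]; first exact: abse_ge0.
  rewrite /summable (_ : (fun=> _) = [set: nat]); last by apply/seteqP.
  by apply: le_lt_trans sp; apply: le_esum => i _ /=; rewrite normr_id.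
apply: (series_le_cvg _ _ _ h) => j //=.
by rewrite normrM ler_piMr //; case: (_ \in A); rewrite ?normr1 ?normr0.
Qed.

(** The partial sums of the shifted series are those of the original one with the
    index delayed by [k]. *)
Lemma cvg_series_shift k f (l : R) : series f @ \oo --> l ->
  series (fun n => if (k <= n)%N then f (n - k)%N else 0) @ \oo --> l.
Proof.
rewrite -(cvg_centern k).
rewrite (_ : [sequence series f (n - k)%N]_n
   = series (fun n => if (k <= n)%N then f (n - k)%N else 0)) //.
apply/funext => n; rewrite /series /=.
elim: n => [|n IH]; first by rewrite sub0n !big_geq.
rewrite big_nat_recr //= -IH; have [kn|nk] := leqP k n.
  by rewrite subSn // big_nat_recr.
have -> : (n.+1 - k = n - k)%N by lia.
by rewrite addr0.
Qed.

Lemma atomic_convolution p q (c : nat -> R) s A :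
  summable [set: nat] (EFin \o p) ->
  (forall n, q n = \sum_(k < s | (k <= n)%N) c k * p (n - k)%N) ->
  atomic q A = (\sum_(k < s) (c k)%:E * atomic p (translate k%:R A))%E.
Proof.
move=> sp qE; pose L (k : 'I_s) : R := limn (atom_series p (translate k%:R A)).
have hL (k : 'I_s) : atom_series p (translate k%:R A) @ \oo --> (L k).
  exact: is_cvg_atom_series.
under eq_bigr => k _ do rewrite (atomic_cvg _ _ _ (hL k)) -EFinM.
rewrite sumEFin; apply: atomic_cvg.
pose g (k : 'I_s) n := if (k <= n)%N
  then p (n - k)%N * (((n - k)%:R : T) \in translate k%:R A)%:R else 0.
have -> : atom_series q A = fun n => \sum_(k < s) c k * series (g k) n.
  apply/funext => n; rewrite /atom_series /series /=.
  under [RHS]eq_bigr do rewrite mulr_sumr.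
  rewrite exchange_big /=; apply: eq_bigr => j _.
  rewrite qE mulr_suml big_mkcond /=; apply: eq_bigr => k _.
  rewrite /g; case: ifPn => kj; rewrite ?mulr0 // mulrA.
  congr (_ * (nat_of_bool _)%:R); apply/idP/idP; rewrite !inE /translate /=.
    by rewrite -natrD subnK.
  by rewrite -natrD subnK.
apply: cvg_big => [|k _]; first exact: add_continuous.
apply: cvgM; first exact: cvg_cst.
exact: (cvg_series_shift k (fun j => p j * ((j%:R : T) \in translate k%:R A)%:R) _ (hL k)).
Qed.

End AtomicMeasures.

Lemma sum_symmetric_range (V : nmodType) (G : int -> V) m :
  G 0 + \sum_(1 <= k < m.+1) (G k%:Z + G (- k%:Z))
  = \sum_(0 <= k < (2 * m).+1) G (k%:Z - m%:Z).
Proof.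
elim: m => [|m IH]; first by rewrite big_geq // addr0 muln0 big_nat1.
rewrite big_nat_recr //= addrA IH.
have -> : (2 * m.+1).+1 = ((2 * m).+2).+1 by lia.
rewrite [RHS]big_nat_recl // [in RHS]big_nat_recr //=.
rewrite [RHS]addrC -addrA.
have -> : 0%:Z - m.+1%:Z = - m.+1%:Z by lia.
have -> : (2 * m).+2%:Z - m.+1%:Z = m.+1%:Z by lia.
by congr (_ + _); apply: eq_bigr => k _; congr G; lia.
Qed.

Section SignedMeasures.
Context {R : realType}.
Local Notation T := (measurableTypeR R).

Lemma big_signed_addE (I : Type) (r : seq I) (F : I -> charge T R) (A : set T) :
  (\big[signed_add/signed0]_(i <- r) F i) A = (\sum_(i <- r) F i A)%E.
Proof.
elim: r => [|i r IH]; first by rewrite !big_nil.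
by rewrite !big_cons -IH.
Qed.

End SignedMeasures.

(** * The decomposition of the generalized distribution *)

Theorem proposition2 (R : realType) (nu : R) (m : nat) (z : complex R)
    (hnu : 2^-1 < nu)
    (hm1 : (1 <= m)%N) (hm2 : m%:Z <= Num.floor (nu - 2^-1))
    (hz : ComplexField.Normc.normc z < 1) :
  let tau : R := ComplexField.Normc.normc z ^+ 2 in
  let x : R := tau / (1 - tau) ^+ 2 in
  let NB := atomic_signed (gnbd nu tau 0) in
  forall A : set (measurableTypeR R), measurable A ->
    atomic (gnbd nu tau m) A
    = charge_conv (charge_conv NB (delta m%:R))
        (signed_add
          (signed_scale (Qpoly nu m 0 x) (delta 0))
          (\big[signed_add/signed0]_(1 <= k < m.+1)
             signed_scale (Qpoly nu m k x)
               (signed_add (delta k%:R) (delta (- k%:R))))) A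
    /\
    atomic (gnbd nu tau m) A
    = charge_conv NB
        (\big[signed_add/signed0]_(0 <= k < (2 * m).+1)
           signed_scale (Qpoly nu m `|k - m|%N x) (delta k%:R)) A.
Proof.
move=> tau x NB A mA.
have tau_ge0 : 0 <= tau by exact: sqr_ge0.
have normz_ge0 : 0 <= ComplexField.Normc.normc z by case: (z) => u v; exact: sqrtr_ge0.
have tau_lt1 : tau < 1 by rewrite /tau expr_lt1.
have b1 : 1 <= 2 * nu - 2 * m%:R.
  have : m%:R <= nu - 2^-1 :> R by move: hm2; rewrite floor_ge_int.
  lra.
have NB_summable : summable [set: nat] (EFin \o gnbd nu tau 0).
  by apply: summable_gnbd0; rewrite ?tau_ge0.
have NBE B : NB B = atomic (gnbd nu tau 0) B.
  by rewrite /NB /atomic_signed /= /atomic_charge asboolT.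
have Q0 k : (2 * m < k)%N -> Qpoly nu m `|k - m|%N x = 0.
  by move=> mk; rewrite /Qpoly big_geq ?mulr0 //; lia.
have key : atomic (gnbd nu tau m) A
  = (\sum_(k < (2 * m).+1) (Qpoly nu m `|k - m|%N x)%:E * NB (translate k%:R A))%E.
  under eq_bigr do rewrite NBE.
  apply: (atomic_convolution _ _ (fun k => Qpoly nu m `|k - m|%N x)) => // n.
  rewrite gnbd_convolution // -/x.
  (* The two ranges [k <= n] and [k <= 2 m] are compared inside a common larger one;
     beyond [2 m] the coefficients vanish. *)
  rewrite (big_ord_widen_cond (n + (2 * m)).+1 xpredT
    (fun k => Qpoly nu m `|k - m|%N x * gnbd nu tau 0 (n - k))) /=; last by lia.
  rewrite [RHS](big_ord_widen_cond (n + (2 * m)).+1 (fun k => k <= n)%N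
    (fun k => Qpoly nu m `|k - m|%N x * gnbd nu tau 0 (n - k))) /=; last by lia.
  rewrite big_mkcond [RHS]big_mkcond /=; apply: eq_bigr => k _; rewrite !ltnS.
  by case: (leqP k n) => //= _; case: leqP => // /Q0 ->; rewrite mul0r.
split; rewrite key.
- rewrite (charge_conv_finite_combination _ _ _
    (fun k : 'I_(2 * m).+1 => Qpoly nu m `|k - m|%N x)
    (fun k : 'I_(2 * m).+1 => k%:R - m%:R)) //.
    apply: eq_bigr => k _; congr (_ * _)%E.
    rewrite (charge_conv_finite_combination _ _ _
      (fun _ : 'I_1 => 1) (fun _ : 'I_1 => m%:R)) //.
    + rewrite big_ord1 mul1e; congr (NB _).
      by apply/seteqP; split => y; rewrite /translate /= -addrA subrKC.
    + by move=> B mB; rewrite big_ord1 mul1e.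
    + exact: measurable_translate.
  move=> B mB.
  (* Both sides are sums over [[- m, m]] of this function of a signed index. *)
  pose G (i : int) : \bar R := ((Qpoly nu m `|i|%N x)%:E * \d_(i%:~R : measurableTypeR R) B)%E.
  transitivity (\sum_(0 <= k < (2 * m).+1) G (k%:Z - m%:Z)%R)%E; last first.
    by rewrite big_mkord; apply: eq_bigr => k _; rewrite /G rmorphB.
  rewrite -sum_symmetric_range.
  rewrite /signed_add /cadd /=; congr (_ + _)%E.
  rewrite -[LHS]/((\big[signed_add/signed0]_(1 <= k < m.+1) _) B) big_signed_addE.
  apply: eq_bigr => k _.
  rewrite /signed_scale /cscale /signed_add /cadd /= /G abszN rmorphN /= -ge0_muleDr //.
- rewrite (charge_conv_finite_combination _ _ _
    (fun k : 'I_(2 * m).+1 => Qpoly nu m `|k - m|%N x)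
    (fun k : 'I_(2 * m).+1 => k%:R)) //.
  by move=> B mB; rewrite big_signed_addE big_mkord.
Qed.
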